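(* Let $\gamma(t)$ be convex closed plane curves evolving by $$\frac{\partial}{\partial t}\gamma(t)=(k-\alpha(t))N,\qquad \alpha(t)=\frac{1}{2\pi}\int_{\gamma(t)} k^{2}\,ds,$$ and let $A(t)$ be the area of the disk bounded by $\gamma(t)$ and $L$ the length of $\gamma(t)$. Then the area is increasing, in the sense that $$\frac{d}{dt}A(t)=\alpha L-2\pi\ge 0 .$$
   Context: A convex curve means a smooth simple closed plane curve, oriented counterclockwise, whose curvature $k$ is positive; in particular $\int_{\gamma(t)} k\,ds=2\pi$. $s$ denotes arclength along $\gamma(t)$, $T=\partial_s\gamma$ the unit tangent, $N$ the inward unit normal, with $\partial_s T=kN$ and $\partial_s N=-kT$. *)

(* Defs.v *)
(* MathComp, with MathComp-Analysis over an arbitrary realType. *)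
From mathcomp Require Import all_boot all_order all_algebra.
From mathcomp Require Import all_classical all_reals all_analysis.

Set Implicit Arguments.
Unset Strict Implicit.
Unset Printing Implicit Defensive.

Import Order.TTheory GRing.Theory Num.Theory.
Import numFieldNormedType.Exports.

Local Open Scope classical_set_scope.
Local Open Scope ring_scope.

(* C^oo on an open set U: every iterated directional derivative of f is
   (Frechet) differentiable at every point of U. *)
Definition smooth_on (R : realType) (V W : normedModType R)
    (U : set V) (f : V -> W) : Prop :=
  forall (vs : seq V) (x : V),
    U x -> differentiable (foldr (fun v g => 'D_v g) f vs) x.

(* The plane is R * R. Its library norm `|_| is the sup norm (which induces the
   usual topology), so the Euclidean structure is introduced separately. *)
Definition dotp (R : realType) (p q : R * R) : R := p.1 * q.1 + p.2 * q.2.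

Definition enorm (R : realType) (p : R * R) : R := Num.sqrt (dotp p p).

(* Rotation by +pi/2. *)
Definition rot90 (R : realType) (p : R * R) : R * R := (- p.2, p.1).

(* A closed curve is given by a parametrization c : R -> R * R of period 1,
   i.e. a map from the circle R / Z. *)
Section ClosedCurve.
Variables (R : realType) (c : R -> R * R).

Definition speed (u : R) : R := enorm (derive1 c u).

(* d/ds = |c'|^-1 d/du *)
Definition arc_derive (W : normedModType R) (f : R -> W) (u : R) : W :=
  (speed u)^-1 *: derive1 f u.

Definition arc_integral (f : R -> R) : R :=
  \int[lebesgue_measure]_(u in `[0, 1]) (f u * speed u).

Definition curve_length : R := arc_integral (fun=> 1).

Definition tangent : R -> R * R := arc_derive c.

(* The left unit normal; it is the inward one on a curve that is
   [counterclockwise] in the sense below. *)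
Definition normal (u : R) : R * R := rot90 (tangent u).

(* The derivative of T with respect to s is orthogonal to T, hence equal to
   k N with k its component along N. *)
Definition curvature (u : R) : R := dotp (arc_derive tangent u) (normal u).

(* The region bounded by the curve: the points of the complement of its image
   that lie in a bounded connected component of that complement. *)
Definition enclosed : set (R * R) :=
  [set p | ~ range c p /\
           bounded_set (connected_component (~` range c) p)].

(* Two-dimensional Lebesgue measure of the enclosed region. *)
Definition enclosed_area : R :=
  fine ((@lebesgue_measure R \x @lebesgue_measure R)%E enclosed).

(* The enclosed region lies to the left of the direction of travel. *)
Definition counterclockwise : Prop :=
  forall u : R, \forall e \near 0^'+, enclosed (c u + e *: normal u).

Record convex_curve : Prop := ConvexCurve {
  convex_periodic : forall u : R, c (u + 1) = c u;
  convex_smooth : smooth_on [set: R] c;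
  convex_regular : forall u : R, derive1 c u != 0;
  convex_simple : forall u v : R,
    0 <= u < 1 -> 0 <= v < 1 -> c u = c v -> u = v;
  convex_counterclockwise : counterclockwise;
  convex_curvature_gt0 : forall u : R, 0 < curvature u
}.

(* (2 pi)^-1 times the integral of k^2 ds *)
Definition mean_curvature_square : R :=
  (2 * pi)^-1 * arc_integral (fun u => curvature u ^+ 2).

End ClosedCurve.

(* Main.v *)
Require Import Defs.
From mathcomp Require Import all_boot all_order all_algebra.
From mathcomp Require Import all_classical all_reals all_analysis.
From mathcomp Require Import ring lra.
Import Order.TTheory GRing.Theory Num.Theory.
Import numFieldNormedType.Exports.
Local Open Scope classical_set_scope.
Local Open Scope ring_scope.
Set Implicit Arguments.
Unset Strict Implicit.
Unset Printing Implicit Defensive.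

(** Parametrise a convex curve by its tangent angle.  Since the curvature is
    positive this angle is a strictly increasing function of the parameter, so
    after the change of variable the curve is a pair [X, Y] with
    [X' = rho * cos] and [Y' = rho * sin] for some [rho > 0] ([angle_param]),
    of period [2 pi m] for an integer [m > 0].

    The turning number [m] is [1] ([turning_once]).  Otherwise
    [w f := (X, Y) (f + 2 pi) - (X, Y) f] never vanishes, by simplicity.  Its
    component [D] along the normal at [f] has derivative minus the component
    [E] of [w] along the tangent.  Where [D] vanishes, the arc between the two
    points makes exactly one turn and joins two points of a common tangent
    line; such an arc rises and then falls over this line, and crosses itself
    if it ends in front of its starting point ([self_intersection]).  Hence
    [E < 0] there, and [D] crosses zero upwards at every one of its zeros.
    This is impossible for a periodic function whose sum over the [m]
    translates by [2 pi] telescopes to zero.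

    With [m = 1] the curve lies to the left of each of its tangent lines, so
    the bounded component of its complement is the intersection of the open
    left half-planes ([enclosed_left_region]).  The vertical slices of this
    region are the intervals between the lower and the upper arc, and
    integrating their lengths gives [A = - \int y dx]
    ([area_left_region], [enclosed_area_primitive]).

    For the inequality, the total curvature is [2 pi] ([total_curvature]) and
    the Cauchy-Schwarz inequality gives [(2 pi)^2 <= L * \int k^2 ds]
    ([mean_curvature_square_length_ge]).

    For the derivative, an integration by parts writes [A(s) - A(t)] as the
    integral of an expression in which [gamma s - gamma t] itself occurs, but
    not its derivative along the curve ([area_difference]).  Differentiating under the
    integral sign at [s = t] then yields the integral of
    [- (k - alpha) |gamma'|], that is [alpha L - 2 pi]. *)

(** * Calculus on the real line *)

Section Calculus.
Context {R : realType}.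
Implicit Types (f g d : R -> R) (x a b : R).

Lemma is_derive_add f g x a b : is_derive x 1 f a -> is_derive x 1 g b ->
  is_derive x 1 (fun t => f t + g t) (a + b).
Proof. by move=> fa gb; exact: is_deriveD. Qed.

Lemma is_derive_sub f g x a b : is_derive x 1 f a -> is_derive x 1 g b ->
  is_derive x 1 (fun t => f t - g t) (a - b).
Proof. by move=> fa gb; exact: is_deriveB. Qed.

Lemma is_derive_opp f x a : is_derive x 1 f a ->
  is_derive x 1 (fun t => - f t) (- a).
Proof. by move=> fa; exact: is_deriveN. Qed.

Lemma is_derive_mul f g x a b : is_derive x 1 f a -> is_derive x 1 g b ->
  is_derive x 1 (fun t => f t * g t) (a * g x + f x * b).
Proof.
by move=> fa gb; apply: is_derive_eq; rewrite addrC /GRing.scale/= (mulrC a).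
Qed.

Lemma is_derive_const a x : is_derive x 1 (fun=> a) (0 : R).
Proof. exact: is_derive_cst. Qed.

Lemma is_derive_scale f x a b : is_derive x 1 f a ->
  is_derive x 1 (fun t => f t * b) (a * b).
Proof.
move=> fa; apply: is_derive_eq (is_derive_mul fa (is_derive_const b x)) _.
by rewrite mulr0 addr0.
Qed.

Lemma is_derive_chain f g x a b : is_derive (g x) 1 f a -> is_derive x 1 g b ->
  is_derive x 1 (fun t => f (g t)) (a * b).
Proof. by move=> fa gb; exact: is_derive1_comp. Qed.

Lemma is_derive_shift f x a b : is_derive (x + b) 1 f a ->
  is_derive x 1 (fun t => f (t + b)) a.
Proof.
move=> fa; have D := is_derive_add (is_derive_id x (1 : R)) (is_derive_const b x).
by apply: is_derive_eq (is_derive_chain (g := fun t => t + b) fa D) _; rewrite addr0 mulr1.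
Qed.

Lemma is_derive_continuous f x a : is_derive x 1 f a -> {for x, continuous f}.
Proof. by move=> [fx _]; apply: differentiable_continuous; exact/derivable1_diffP. Qed.

Lemma derive_gt0_incr f d a b : (forall x, is_derive x 1 f (d x)) ->
  (forall x, a < x < b -> 0 < d x) ->
  forall x y, a <= x -> x < y -> y <= b -> f x < f y.
Proof.
move=> fd d0 x y ax xy yb.
have [|z] := @MVT R f d x y xy (fun z _ => fd z).
  by apply: continuous_subspaceT => z; exact: is_derive_continuous (fd z).
rewrite in_itv/= => /andP[xz zy] E.
by rewrite -subr_gt0 E mulr_gt0 ?subr_gt0// d0// (le_lt_trans ax xz) (lt_le_trans zy).
Qed.

(** Integrating from [-1] gives a primitive to the right of [-1]; applied to the
    reflected function it gives one to the left of [1].  The two differ by a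
    constant on the overlap, so they can be glued at [0]. *)
Lemma primitive_exists f : continuous f -> exists F : R -> R, forall x, is_derive x 1 F (f x).
Proof.
have key (h : R -> R) : continuous h -> exists H : R -> R, forall x, -1 < x -> is_derive x 1 H (h x).
  move=> ch; exists (fun x => \int[lebesgue_measure]_(t in `[-1, x]) h t) => x x1.
  have [||||dF F'] := @continuous_FTC1_closed R h (-1) x (x + 1).
  - by rewrite ltrDl.
  - by apply: continuous_compact_integrable; [exact: segment_compact|exact: continuous_subspaceT].
  - by [].
  - exact: ch.
  by apply: (DeriveDef dF); rewrite -derive1E.
move=> cf; have [F1 dF1] := key _ cf.
have [|F2 dF2] := key (fun x => f (- x)).
  by move=> x; apply: continuous_comp; [exact: opp_continuous|exact: cf].
pose G x := - F2 (- x).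
have dG x : x < 1 -> is_derive x 1 G (f x).
  move=> x1; have xN1 : -1 < - x by rewrite ltrN2.
  have D := is_derive_opp (is_derive_id x (1 : R)).
  have := is_derive_opp (is_derive_chain (g := fun t => - t) (dF2 _ xN1) D).
  by rewrite opprK => D'; apply: is_derive_eq D' _; rewrite mulrN1 opprK.
have FG x : -1 < x < 1 -> F1 x - G x = F1 0 - G 0.
  have D (z : R) : -1 < z < 1 -> is_derive z 1 (fun t => F1 t - G t) 0.
    move=> /andP[z0 z1]; apply: is_derive_eq (is_derive_sub (dF1 _ z0) (dG _ z1)) _.
    exact: subrr.
  move=> /andP[x0 x1]; have [x_lt0|x_gt0|->//] := ltgtP x 0.
    have [| |z _] := @MVT R (fun t => F1 t - G t) (fun=> 0) x 0 x_lt0.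
    - by move=> z; rewrite in_itv/= => /andP[xz z0]; apply: D; rewrite (lt_trans x0 xz) (lt_trans z0).
    - apply: derivable_within_continuous => z; rewrite in_itv/= => /andP[xz z0].
      by apply: (@ex_derive _ _ _ _ _ _ 0); apply: D; rewrite (lt_le_trans x0 xz) (le_lt_trans z0).
    by rewrite mul0r => /eqP; rewrite subr_eq0 => /eqP.
  have [| |z _] := @MVT R (fun t => F1 t - G t) (fun=> 0) 0 x x_gt0.
  - by move=> z; rewrite in_itv/= => /andP[xz z0]; apply: D; rewrite (lt_trans _ xz) ?(lt_trans z0)// ltrN10.
  - apply: derivable_within_continuous => z; rewrite in_itv/= => /andP[xz z0].
    by apply: (@ex_derive _ _ _ _ _ _ 0); apply: D; rewrite (lt_le_trans _ xz) ?(le_lt_trans z0)// ltrN10.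
  by rewrite mul0r => /eqP; rewrite subr_eq0 => /eqP.
exists (fun x => if 0 < x then F1 x - F1 0 else G x - G 0) => x.
have [x0|x0] := ltP 0 x.
  apply: (@near_eq_is_derive _ _ _ (fun t => F1 t - F1 0)).
    by near=> t; rewrite ifT//; near: t; exact: lt_nbhsr.
  apply: is_derive_eq (is_derive_sub (dF1 x _) (is_derive_const _ _)) _.
  - by rewrite (lt_trans _ x0)// ltrN10.
  - by rewrite subr0.
apply: (@near_eq_is_derive _ _ _ (fun t => G t - G 0)).
  near=> t; case: ifPn => // t0.
  suff : F1 t - G t = F1 0 - G 0 by lra.
  apply: FG; rewrite (lt_trans _ t0) ?ltrN10//=.
  by near: t; apply: lt_nbhsl; rewrite (le_lt_trans x0).
apply: is_derive_eq (is_derive_sub (dG x _) (is_derive_const _ _)) _.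
- by rewrite (le_lt_trans x0).
- by rewrite subr0.
Unshelve. all: by end_near. Qed.

Lemma Rintegral_primitive f d a b : a < b -> continuous d -> (forall x, is_derive x 1 f (d x)) ->
  \int[lebesgue_measure]_(u in `[a, b]) d u = f b - f a.
Proof.
move=> ab cd fd; rewrite /Rintegral (@continuous_FTC2 _ d f)//.
- exact: continuous_subspaceT.
- have cf x : {for x, continuous f} := is_derive_continuous (fd x).
  split; [by move=> x _; exact: ex_derive|apply: cvg_at_right_filter; exact: cf|apply: cvg_at_left_filter; exact: cf].
- by move=> x _; rewrite derive1E; exact: derive_val.
Qed.

(** The inverse branch is asked to be continuous on the whole line, beyond the
    image of the segment, so that it composes with other functions without
    tracking domains. *)
Lemma segment_inverse f d a b : a < b -> (forall x, is_derive x 1 f (d x)) ->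
  (forall x, a < x < b -> 0 < d x) ->
  exists g, [/\ continuous g, forall x, a <= x <= b -> g (f x) = x,
    forall y, f a <= y <= f b -> a <= g y <= b /\ f (g y) = y &
    forall y, f a < y < f b -> is_derive y 1 g (d (g y))^-1].
Proof.
move=> ab fd d0; have incf := derive_gt0_incr fd d0.
have cf : continuous f by move=> x; exact: is_derive_continuous (fd x).
have inj x y : a <= x <= b -> a <= y <= b -> f x = f y -> x = y.
  move=> /andP[ax xb] /andP[ay yb] fxy; have [xy|yx|//] := ltgtP x y.
    by have := incf _ _ ax xy yb; rewrite fxy ltxx.
  by have := incf _ _ ay yx xb; rewrite fxy ltxx.
have le_f y z : a <= y -> y <= z -> z <= b -> f y <= f z.
  by move=> ay; rewrite le_eqVlt => /predU1P[->//|yz zb]; exact/ltW/incf.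
have fab : f a < f b by exact: incf.
have /choice[g gP] y : exists x, f a <= y <= f b -> a <= x <= b /\ f x = y.
  have [/andP[y1 y2]|ny] := boolP (f a <= y <= f b); last by exists a.
  have [||x] := @IVT R f a b y (ltW ab).
  - exact: continuous_subspaceT.
  - by rewrite min_l ?max_r ?(ltW fab)// y1.
  by rewrite in_itv/= => xab <-; exists x.
have gf x : a <= x <= b -> g (f x) = x.
  move=> xab; have /andP[ax xb] := xab.
  have [|gab fg] := gP (f x); first by rewrite !le_f.
  exact: inj.
have wcg : {within `[f a, f b], continuous g}.
  apply: (segment_can_le_continuous (ltW ab) (continuous_subspaceT cf)) => x.
  by rewrite in_itv/= => /gf.
(* Clamping the argument to the segment makes the inverse continuous on the whole line. *)
pose clamp y := Num.max (f a) (Num.min y (f b)).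
have clampE y : f a <= y <= f b -> clamp y = y.
  by move=> /andP[y1 y2]; rewrite /clamp min_l// max_r.
have clampP y : f a <= clamp y <= f b.
  by rewrite /clamp le_max lexx /= ge_max ltW //= ge_min lexx orbT.
exists (g \o clamp); split.
- move=> y; have cc : {for y, continuous clamp}.
    apply: continuous_max; first exact: cst_continuous.
    by apply: continuous_min; [exact: cvg_id|exact: cst_continuous].
  apply: (@cvg_comp _ _ _ clamp g _ (within `[f a, f b] (nbhs (clamp y)))).
    move=> U /cc UU.
    have : \forall z \near y, `[f a, f b]%classic (clamp z) -> U (clamp z) by [].
    by apply: (@filterS _ (nbhs y)) => z; apply; rewrite /= in_itv/=; exact: clampP.
  by move/subspace_continuousP: wcg; apply; rewrite /= in_itv/=; exact: clampP.
- move=> x xab; have /andP[ax xb] := xab.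
  by rewrite /= clampE ?gf// !le_f.
- by move=> y yab; rewrite /= clampE//; exact: gP.
- move=> y /andP[ay yb]; have yab : f a <= y <= f b by rewrite !ltW.
  have /= := clampE _ yab => ->; have [/andP[ag gb] fg] := gP y yab.
  have gab : a < g y < b.
    rewrite !lt_neqAle ag gb !andbT; apply/andP; split; apply/eqP => E.
      by move: ay; rewrite -fg -E ltxx.
    by move: yb; rewrite -fg E ltxx.
  have := @is_derive_inverse R f (g \o clamp) (d (g y)) (g y); rewrite fg; apply.
  + have gI : g y \in `]a, b[ by rewrite in_itv.
    near=> x; have : x \in `]a, b[ by near: x; exact: near_in_itvoo.
    rewrite in_itv/= => /andP[ax xb].
    have axb : a <= x <= b by rewrite !ltW.
    have fxab : f a <= f x <= f b by rewrite !le_f// ltW.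
    by rewrite /= (clampE _ fxab) gf.
  + by near=> x; exact: cf.
  + by rewrite gt_eqF// d0.
Unshelve. all: by end_near. Qed.

Lemma near_gt0 f x : {for x, continuous f} -> 0 < f x ->
  \forall t \near x, 0 < f t.
Proof. by move=> cf fx; have := cf _ (lt_nbhsr fx). Qed.

Lemma is_derive_pos_sign f x a : is_derive x 1 f a -> 0 < a -> f x = 0 ->
  \forall t \near x, (t < x -> f t < 0) /\ (x < t -> 0 < f t).
Proof.
move=> /is_derive1_caratheodory[g [fE cg ga]] a0 fx0; rewrite -ga in a0.
apply: filterS (near_gt0 cg a0) => t gt0.
have := fE t; rewrite fx0 subr0 => ->; split => tx.
  by rewrite pmulr_rlt0// subr_lt0.
by rewrite mulr_gt0// subr_gt0.
Qed.

(** The point is the last one at which [f] is nonnegative: a positive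
    derivative there would produce a later one. *)
Lemma down_crossing f d a b : (forall x, is_derive x 1 f (d x)) ->
  a < b -> 0 <= f a -> f b < 0 -> exists s, f s = 0 /\ d s <= 0.
Proof.
move=> fd ab fa fb; pose S := [set x | a <= x <= b /\ 0 <= f x].
have cf x : {for x, continuous f} := is_derive_continuous (fd x).
have Sa : S a by rewrite /S/= lexx ltW.
have ubS : has_ubound S by exists b => x [/andP[]].
have supS : has_sup S by split => //; exists a.
set s := sup S.
have as_ : a <= s by exact: ub_le_sup.
have sb : s <= b by apply: ge_sup => [|x [/andP[]]//]; exists a.
have fs0 : 0 <= f s.
  rewrite leNgt; apply/negP => fs.
  have cNf : {for s, continuous (fun t => - f t)} by apply: continuousN; exact: cf.
  have Nfs : 0 < - f s by rewrite oppr_gt0.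
  have /nbhs_ballP[e /= e0 He] := near_gt0 cNf Nfs.
  have [x Sx xs] := sup_adherent e0 supS.
  have := He x; rewrite /ball/= => Hx.
  have xs' : x <= s by exact: ub_le_sup.
  have : f x < 0 by rewrite -oppr_gt0; apply: Hx; rewrite ger0_norm ?subr_ge0// ltrBlDr -ltrBlDl.
  by rewrite ltNge; case: Sx => _ ->.
have sb' : s < b.
  by rewrite lt_neqAle sb andbT; apply: contraTneq fb => <-; rewrite -leNgt.
have nopos : ~ \forall t \near s, s < t -> 0 < f t.
  move=> /nbhs_ballP[e /= e0 He].
  pose t := Num.min b (s + e / 2).
  have st : s < t by rewrite lt_min sb' ltrDl divr_gt0.
  have tse : t <= s + e / 2 by rewrite ge_min lexx orbT.
  have ft : 0 < f t.
    apply: He => //; rewrite /ball/= ltr0_norm ?subr_lt0//; lra.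
  have : t <= s.
    apply: ub_le_sup => //; split; last exact: ltW.
    by rewrite (le_trans as_ (ltW st)) ge_min lexx.
  by rewrite leNgt st.
exists s; split.
  apply/eqP; rewrite eq_le fs0 andbT leNgt; apply/negP => fs.
  by apply: nopos; apply: filterS (near_gt0 (cf s) fs).
rewrite leNgt; apply/negP => ds.
have [fs|fs] := eqVneq (f s) 0.
  by apply: nopos; apply: filterS (is_derive_pos_sign (fd s) ds fs) => t [].
have {}fs : 0 < f s by rewrite lt_neqAle eq_sym fs.
by apply: nopos; apply: filterS (near_gt0 (cf s) fs).
Qed.

End Calculus.

(** * The tangent angle as parameter, and the turning number *)

Section AngleParam.
Context {R : realType}.
Implicit Types X Y rho : R -> R.

(** [rho] is the radius of curvature: the arclength per unit of angle. *)
Definition angle_param X Y rho := forall f : R,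
  [/\ 0 < rho f, is_derive f 1 X (rho f * cos f) & is_derive f 1 Y (rho f * sin f)].

Lemma sin_per (f : R) : sin (f + 2 * pi) = sin f.
Proof. by rewrite mulr_natl sinD2pi. Qed.

Lemma cos_per (f : R) : cos (f + 2 * pi) = cos f.
Proof. by rewrite mulr_natl cosD2pi. Qed.

Lemma pi2_gt0 : 0 < 2 * pi :> R.
Proof. by rewrite mulr_gt0// pi_gt0. Qed.

(** The curve seen in the frame of the tangent and the normal at [a], with the
    angle counted from [a]. *)
Definition rotX X Y a f : R := X (f + a) * cos a + Y (f + a) * sin a.
Definition rotY X Y a f : R := Y (f + a) * cos a - X (f + a) * sin a.

Lemma angle_param_rot X Y rho a : angle_param X Y rho ->
  angle_param (rotX X Y a) (rotY X Y a) (fun f => rho (f + a)).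
Proof.
move=> XY f; have [r0 dX dY] := XY (f + a).
have dXs := is_derive_shift dX; have dYs := is_derive_shift dY.
split => //.
  apply: is_derive_eq (is_derive_add (is_derive_scale (cos a) dXs)
    (is_derive_scale (sin a) dYs)) _.
  by have -> : cos f = cos (f + a - a) by [rewrite addrK]; rewrite cosB; ring.
apply: is_derive_eq (is_derive_sub (is_derive_scale (cos a) dYs)
    (is_derive_scale (sin a) dXs)) _.
by have -> : sin f = sin (f + a - a) by [rewrite addrK]; rewrite sinB; ring.
Qed.

Lemma rotX_pi X Y f : rotX X Y pi f = - X (f + pi).
Proof. by rewrite /rotX cospi sinpi; ring. Qed.

Lemma rotY_pi X Y f : rotY X Y pi f = - Y (f + pi).
Proof. by rewrite /rotY cospi sinpi; ring. Qed.

Section Monotone.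
Variables X Y rho : R -> R.
Hypothesis XY : angle_param X Y rho.

Lemma angleX_derive (f : R) : is_derive f 1 X (rho f * cos f).
Proof. by have [] := XY f. Qed.

Lemma angleY_derive (f : R) : is_derive f 1 Y (rho f * sin f).
Proof. by have [] := XY f. Qed.

Lemma angleX_gt0 (f : R) : - (pi / 2) < f < pi / 2 -> 0 < rho f * cos f.
Proof. by move=> fpi; have [r0 _ _] := XY f; rewrite mulr_gt0// cos_gt0_pihalf. Qed.

Lemma angleY_gt0 (f : R) : 0 < f < pi -> 0 < rho f * sin f.
Proof. by move=> fpi; have [r0 _ _] := XY f; rewrite mulr_gt0// sin_gt0_pi. Qed.

Lemma angleX_incr f g : - (pi / 2) <= f -> f < g -> g <= pi / 2 -> X f < X g.
Proof. exact: derive_gt0_incr angleX_derive angleX_gt0 f g. Qed.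

Lemma angleY_incr f g : 0 <= f -> f < g -> g <= pi -> Y f < Y g.
Proof. exact: derive_gt0_incr angleY_derive angleY_gt0 f g. Qed.

End Monotone.

(** Half a turn exchanges the increasing and the decreasing branches. *)
Lemma angleX_decr X Y rho f g : angle_param X Y rho ->
  pi / 2 <= f -> f < g -> g <= pi + pi / 2 -> X g < X f.
Proof.
move=> XY pf fg gp; have := angleX_incr (angle_param_rot pi XY) (f := f - pi) (g := g - pi).
by rewrite !rotX_pi !subrK ltrN2; apply; lra.
Qed.

Lemma angleY_decr X Y rho f g : angle_param X Y rho ->
  pi <= f -> f < g -> g <= 2 * pi -> Y g < Y f.
Proof.
move=> XY pf fg gp; have := angleY_incr (angle_param_rot pi XY) (f := f - pi) (g := g - pi).
by rewrite !rotY_pi !subrK ltrN2; apply; lra.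
Qed.

Lemma angleY_gt_ends X Y rho f : angle_param X Y rho -> Y (2 * pi) = Y 0 ->
  0 < f < 2 * pi -> Y 0 < Y f.
Proof.
move=> XY Y0 /andP[f0 f2]; have [fpi|pif] := lerP f pi.
  exact: angleY_incr XY _ _ _ f0 fpi.
by rewrite -Y0; exact: angleY_decr XY (ltW pif) f2 _.
Qed.

(** Over each height [h] the rising half [0, pi] and the falling half
    [pi, 2 pi] of the arc have one point each; [E h] below is the horizontal
    distance from the first to the second.  It is positive at the base line by
    hypothesis and negative near the top. *)
Lemma self_intersection X Y rho : angle_param X Y rho ->
  Y (2 * pi) = Y 0 -> X 0 < X (2 * pi) ->
  exists f g, [/\ 0 <= f, f < g, g < f + 2 * pi, X f = X g & Y f = Y g].
Proof.
move=> XY Y02 X02; have pi0 := pi_gt0 R.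
have XY' := angle_param_rot pi XY.
have [g1 [cg1 g1Y Yg1 _]] := segment_inverse pi0 (angleY_derive XY) (angleY_gt0 XY).
have [g2 [cg2 g2Y Yg2 _]] := segment_inverse pi0 (angleY_derive XY') (angleY_gt0 XY').
pose E h := X (g2 (- h) + pi) - X (g1 h).
have cX (f : R) : {for f, continuous X} := is_derive_continuous (angleX_derive XY f).
have cE : continuous E.
  move=> h; apply: cvgB; last by apply: continuous_comp; [exact: cg1|exact: cX].
  apply: (@continuous_comp _ _ _ (fun h => g2 (- h) + pi) X); last exact: cX.
  apply: cvgD; last exact: cvg_cst.
  by apply: (@continuous_comp _ _ _ (fun h : R => - h) g2); [exact: opp_continuous|exact: cg2].
have Y0pi : Y 0 < Y pi by exact: angleY_incr XY _ _ _ _ _.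
have rot0 : rotY X Y pi 0 = - Y pi by rewrite rotY_pi add0r.
have rotpi : rotY X Y pi pi = - Y 0 by rewrite rotY_pi -Y02 mulr_natl.
rewrite rot0 rotpi in Yg2.
have E0 : 0 < E (Y 0).
  by rewrite /E -rotpi g2Y ?g1Y ?lexx ?ltW// subr_gt0 -mulr2n -mulr_natl.
(* Just below the top of the arc the curve runs leftwards, so the rising
   branch lies to the right. *)
pose h1 := Num.max (Y (pi / 2)) (Y (pi + pi / 2)).
have h1pi : h1 < Y pi.
  by rewrite gt_max (angleY_incr XY) ?(angleY_decr XY) //; lra.
have h10 : Y 0 <= h1.
  by rewrite le_max ltW// (angleY_incr XY)//; lra.
have [/andP[a0 a1] Ya] : 0 <= g1 h1 <= pi /\ Y (g1 h1) = h1.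
  by apply: Yg1; rewrite h10 ltW.
have [/andP[b0 b1] Yb] : 0 <= g2 (- h1) <= pi /\ rotY X Y pi (g2 (- h1)) = - h1.
  by apply: Yg2; rewrite !lerN2 h10 ltW.
move: Yb; rewrite rotY_pi => /oppr_inj Yb.
have E1 : E h1 < 0.
  rewrite subr_lt0; apply: (angleX_decr XY).
  - rewrite leNgt; apply/negP => lt_a; have : Y (g1 h1) < Y (pi / 2).
      by apply: (angleY_incr XY) => //; lra.
    by rewrite Ya ltNge le_max lexx.
  - rewrite lt_neqAle (le_trans a1) ?lerDr// andbT; apply: contraTneq h1pi => ab.
    have g1pi : g1 h1 = pi by apply/eqP; rewrite eq_le a1 ab lerDr.
    by rewrite -Ya g1pi ltxx.
  - rewrite leNgt; apply/negP => lt_b; have : Y (g2 (- h1) + pi) < Y (pi + pi / 2).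
      by apply: (angleY_decr XY) => //; lra.
    by rewrite Yb ltNge le_max lexx orbT.
have [||h] := @IVT R E (Y 0) h1 0 h10.
- exact: continuous_subspaceT.
- by rewrite ge_min le_max (ltW E1) (ltW E0) orbT.
rewrite in_itv/= => /andP[h0 hh1] Eh.
have hpi : h < Y pi by exact: le_lt_trans h1pi.
have [/andP[c0 c1] Yc] : 0 <= g1 h <= pi /\ Y (g1 h) = h.
  by apply: Yg1; rewrite h0 ltW.
have [/andP[d0 d1] Yd] : 0 <= g2 (- h) <= pi /\ rotY X Y pi (g2 (- h)) = - h.
  by apply: Yg2; rewrite !lerN2 h0 ltW.
move: Yd; rewrite rotY_pi => /oppr_inj Yd.
have Xcd : X (g1 h) = X (g2 (- h) + pi) by apply/esym/eqP; rewrite -subr_eq0; apply/eqP.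
exists (g1 h), (g2 (- h) + pi); split => //.
- rewrite lt_neqAle (le_trans c1) ?lerDr// andbT; apply: contraTneq hpi => ab.
  have g1pi : g1 h = pi by apply/eqP; rewrite eq_le c1 ab lerDr.
  by rewrite -Yc g1pi ltxx.
- have [c_gt0|c_le0] := ltrP 0 (g1 h); first by lra.
  rewrite ltNge; apply/negP => d2.
  have c00 : g1 h = 0 by lra.
  have d2pi : g2 (- h) + pi = 2 * pi by lra.
  by move: X02; rewrite -c00 -d2pi Xcd ltxx.
- by rewrite Yc Yd.
Qed.

(** [D f] and [E f] below are the components of the chord from [f] to
    [f + 2 pi] along the normal and the tangent at [f]. *)
Lemma turning_once X Y rho (m : nat) : angle_param X Y rho ->
  (0 < m)%N ->
  (forall f, X (f + m%:R * (2 * pi)) = X f) ->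
  (forall f, Y (f + m%:R * (2 * pi)) = Y f) ->
  (forall f g, f < g -> g < f + m%:R * (2 * pi) -> X f = X g -> Y f <> Y g) ->
  m = 1%N.
Proof.
move=> XY m0 perX perY inj; apply/eqP; rewrite eqn_leq m0 andbT leqNgt; apply/negP => m1.
have pi20 := pi2_gt0; set T := m%:R * (2 * pi) in perX perY inj.
have T2 : 2 * pi < T by rewrite /T ltr_pMl// ltr1n.
pose D f := (Y (f + 2 * pi) - Y f) * cos f - (X (f + 2 * pi) - X f) * sin f.
pose E f := (X (f + 2 * pi) - X f) * cos f + (Y (f + 2 * pi) - Y f) * sin f.
have dD (f : R) : is_derive f 1 D (- E f).
  have dX := angleX_derive XY; have dY := angleY_derive XY.
  have dX2 := is_derive_sub (is_derive_shift (dX (f + 2 * pi))) (dX f).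
  have dY2 := is_derive_sub (is_derive_shift (dY (f + 2 * pi))) (dY f).
  apply: is_derive_eq (is_derive_sub (is_derive_mul dY2 (is_derive_cos f))
    (is_derive_mul dX2 (is_derive_sin f))) _.
  by rewrite cos_per sin_per /E; ring.
(* At a zero of D the two points f and f + 2 pi have the same tangent line;
   the arc between them makes one full turn and can only be simple if it ends
   behind its starting point. *)
have upward f : D f = 0 -> 0 < - E f.
  move=> Df; rewrite oppr_gt0 ltNge; apply/negP; rewrite le_eqVlt => /predU1P[E0|E0].
    have c1 := cos2Dsin2 f.
    have X0 : X (f + 2 * pi) - X f = 0.
      transitivity (E f * cos f - D f * sin f); last by rewrite -E0 Df; ring.
      rewrite /E /D -[LHS]mulr1 -c1; ring.
    have Y0 : Y (f + 2 * pi) - Y f = 0.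
      transitivity (E f * sin f + D f * cos f); last by rewrite -E0 Df; ring.
      rewrite /E /D -[LHS]mulr1 -c1; ring.
    apply: (inj f (f + 2 * pi)); rewrite ?ltrDl// ?ltrD2l//.
      by apply/esym/eqP; rewrite -subr_eq0 X0.
    by apply/esym/eqP; rewrite -subr_eq0 Y0.
  have [||a [b [a0 ab b2 Xab Yab]]] := self_intersection (angle_param_rot f XY).
  - apply/eqP; rewrite -subr_eq0; apply/eqP; rewrite -[RHS]Df.
    by rewrite /rotY /D add0r (addrC (2 * pi)); ring.
  - rewrite -subr_gt0 (lt_le_trans E0)// le_eqVlt; apply/orP; left; apply/eqP.
    by rewrite /rotX /E add0r (addrC (2 * pi)); ring.
  have c1 := cos2Dsin2 f.
  have XE : X (a + f) = X (b + f).
    transitivity (rotX X Y f a * cos f - rotY X Y f a * sin f).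
      by rewrite /rotX /rotY -[LHS]mulr1 -c1; ring.
    by rewrite Xab Yab /rotX /rotY -[RHS]mulr1 -c1; ring.
  have YE : Y (a + f) = Y (b + f).
    transitivity (rotX X Y f a * sin f + rotY X Y f a * cos f).
      by rewrite /rotX /rotY -[LHS]mulr1 -c1; ring.
    by rewrite Xab Yab /rotX /rotY -[RHS]mulr1 -c1; ring.
  by apply: (inj (a + f) (b + f)) => //; lra.
pose p j := j%:R * (2 * pi) : R.
have sumD : \sum_(0 <= j < m) D (p j) = 0.
  rewrite (eq_bigr (fun j => Y (p j.+1) - Y (p j))).
    rewrite telescope_sumr//; have := perY 0.
    by rewrite add0r /T /p mul0r => ->; rewrite subrr.
  move=> j _; rewrite /D; have -> : p j + 2 * pi = p j.+1 by rewrite /p -[j.+1]addn1 natrD; ring.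
  suff [-> ->] : cos (p j) = 1 /\ sin (p j) = 0 by ring.
  elim: j => [|j [IHc IHs]]; first by rewrite /p mul0r cos0 sin0.
  have -> : p j.+1 = p j + 2 * pi by rewrite /p -[j.+1]addn1 natrD; ring.
  by rewrite cos_per sin_per.
have perD f (n : nat) : D (f + n%:R * T) = D f.
  elim: n => [|n <-]; first by rewrite mul0r addr0.
  have pX g : X (g + T) = X g := perX g.
  have -> : f + n.+1%:R * T = (f + n%:R * T) + T by rewrite -[n.+1]addn1 natrD; ring.
  set g := f + _.
  have cT : cos (g + T) = cos g.
    rewrite /T; elim: (m) => [|k IH]; first by rewrite mul0r addr0.
    by rewrite -IH -[RHS]cos_per -[k.+1]addn1 natrD; congr cos; ring.
  have sT : sin (g + T) = sin g.
    rewrite /T; elim: (m) => [|k IH]; first by rewrite mul0r addr0.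
    by rewrite -IH -[RHS]sin_per -[k.+1]addn1 natrD; congr sin; ring.
  by rewrite /D cT sT addrAC perX perY perX perY.
have [a Da] : exists a, 0 <= D a.
  apply/not_existsP => neg; have : \sum_(0 <= j < m) D (p j) < 0.
    rewrite -(prednK m0) big_nat_recl//= ltr_nwDl//; first by rewrite ltNge; apply/negP/neg.
    by apply: sumr_le0 => j _; rewrite leNgt; apply/negP => /ltW; exact: neg.
  by rewrite sumD ltxx.
have [b Db] : exists b, D b < 0.
  have [b Db] : exists b, D b <= 0.
    apply/not_existsP => pos; have : 0 < \sum_(0 <= j < m) D (p j).
      rewrite -(prednK m0) big_nat_recl//= ltr_pwDl//; first by rewrite ltNge; apply/negP/pos.
      by apply: sumr_ge0 => j _; rewrite leNgt; apply/negP => /ltW; exact: pos.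
    by rewrite sumD ltxx.
  move: Db; rewrite le_eqVlt => /predU1P[Db|]; last by exists b.
  have /nbhs_ballP[e /= e0 He] := is_derive_pos_sign (dD b) (upward b Db) Db.
  exists (b - e / 2); apply He; last by rewrite gtrBl divr_gt0.
  by rewrite /ball/= opprB addrC subrK ger0_norm; lra.
(* By periodicity a negative value also occurs after a nonnegative one. *)
have T0 : 0 < T by exact: lt_trans T2.
have [n an] : exists n : nat, a < b + n%:R * T.
  exists (Num.bound `|(a - b) / T|); rewrite -ltrBlDl -ltr_pdivrMr//.
  by rewrite (le_lt_trans (ler_norm _))// archi_boundP.
have [|s [Ds]] := down_crossing dD an Da; first by rewrite perD.
by rewrite leNgt upward.
Qed.

End AngleParam.

(** * The region enclosed by a curve of turning number one *)

(** The last component transports any function of period [T], whatever its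
    codomain, so that one reduction serves several functions at once. *)
Lemma periodic_representative (R : realType) (T a f : R) : 0 < T ->
  exists f', [/\ a <= f' < a + T, exists k : int, f' = f - k%:~R * T &
    forall (A : Type) (g : R -> A), (forall x, g (x + T) = g x) -> g f' = g f].
Proof.
move=> T0; pose k := Num.floor ((f - a) / T).
exists (f - k%:~R * T); split; [|by exists k|].
  have /andP[k1 k2] := real_floor_itv (num_real ((f - a) / T)).
  rewrite -/k in k1 k2; apply/andP; split.
    by move: k1; rewrite ler_pdivlMr//; lra.
  by move: k2; rewrite ltr_pdivrMr// intrD; lra.
move=> A g perg; have pern n x : g (x + n%:R * T) = g x.
  elim: n => [|n <-]; first by rewrite mul0r addr0.
  by rewrite -[in LHS]addn1 natrD mulrDl mul1r addrA perg.
case: k => n.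
  by rewrite -[f in RHS](subrK (n%:R * T)) pern.
by rewrite NegzE mulrNz mulNr opprK; exact: pern.
Qed.

Section ConvexRegion.
Context {R : realType}.
Variables X Y rho : R -> R.
Hypothesis XY : angle_param X Y rho.
Hypothesis perX : forall f, X (f + 2 * pi) = X f.
Hypothesis perY : forall f, Y (f + 2 * pi) = Y f.

Definition tangent_side (v : R) (p : R * R) : R :=
  (p.2 - Y v) * cos v - (p.1 - X v) * sin v.

Definition left_region : set (R * R) := [set p | forall v, 0 < tangent_side v p].

Let c f := (X f, Y f).

Lemma tangent_side_per v p : tangent_side (v + 2 * pi) p = tangent_side v p.
Proof. by rewrite /tangent_side perX perY cos_per sin_per. Qed.

(** Seen from the tangent line at [v], a full turn of the curve starts and ends
    at height zero, first rising and then falling. *)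
Lemma tangent_side_curve_gt0 v f : v < f < v + 2 * pi -> 0 < tangent_side v (c f).
Proof.
move=> /andP[vf fv].
have := @angleY_gt_ends _ _ _ _ (f - v) (angle_param_rot v XY).
rewrite /rotY subrK add0r (addrC (2 * pi)) perX perY => /(_ erefl).
rewrite subr_gt0 vf ltrBlDl fv => /(_ isT).
by rewrite -subr_gt0 /tangent_side/=; congr (0 < _); ring.
Qed.

Lemma tangent_side_self v : tangent_side v (c v) = 0.
Proof. by rewrite /tangent_side/=; ring. Qed.

Lemma tangent_side_curve_ge0 v f : 0 <= tangent_side v (c f).
Proof.
have [f' [/andP[vf' f'v] _ rep]] := periodic_representative v f (pi2_gt0 (R := R)).
rewrite /c -(rep _ X perX) -(rep _ Y perY).
move: vf'; rewrite le_eqVlt => /predU1P[<-|vf'].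
  by rewrite tangent_side_self.
by rewrite ltW// tangent_side_curve_gt0// vf'.
Qed.

Lemma is_derive_tangent_side (v : R) (p : R * R) : is_derive v 1 (tangent_side ^~ p)
  (- ((p.2 - Y v) * sin v) - (p.1 - X v) * cos v).
Proof.
have dX := angleX_derive XY v; have dY := angleY_derive XY v.
have dpX := is_derive_sub (is_derive_const p.1 v) dX.
have dpY := is_derive_sub (is_derive_const p.2 v) dY.
apply: is_derive_eq (is_derive_sub (is_derive_mul dpY (is_derive_cos v))
    (is_derive_mul dpX (is_derive_sin v))) _.
ring.
Qed.

Lemma is_derive_min0 (h : R -> R) (v d : R) : (forall x, 0 <= h x) -> h v = 0 ->
  is_derive v 1 h d -> d = 0.
Proof.
move=> h0 hv dh; apply/eqP; rewrite eq_le; apply/andP; split; rewrite leNgt; apply/negP => d0.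
  have /nbhs_ballP[e /= e0 He] := is_derive_pos_sign dh d0 hv.
  have [|neg _] := He (v - e / 2).
    by rewrite /ball/= opprB addrC subrK ger0_norm; lra.
  by have := h0 (v - e / 2); rewrite leNgt neg// gtrBl divr_gt0.
have [d0' hv'] : 0 < - d /\ - h v = 0 by rewrite oppr_gt0 hv oppr0.
have /nbhs_ballP[e /= e0 He] := is_derive_pos_sign (is_derive_opp dh) d0' hv'.
have [|_ pos] := He (v + e / 2).
  by rewrite /ball/= opprD addrA subrr sub0r normrN ger0_norm; lra.
by have := h0 (v + e / 2); rewrite leNgt -oppr_gt0 pos// ltrDl divr_gt0.
Qed.

(** On the boundary of the region the distance to the tangent line at [v] is
    minimal in [v], so its derivative vanishes and the point is the contact point. *)
Lemma tangent_side0 v p : (forall w, 0 <= tangent_side w p) ->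
  tangent_side v p = 0 -> p = c v.
Proof.
move=> p0 pv; have d0 := is_derive_min0 p0 pv (is_derive_tangent_side v p).
have c1 := cos2Dsin2 v.
have X0 : p.1 - X v = 0.
  transitivity (- (- ((p.2 - Y v) * sin v) - (p.1 - X v) * cos v) * cos v
     - tangent_side v p * sin v); last by rewrite d0 pv; ring.
  by rewrite /tangent_side -[LHS]mulr1 -c1; ring.
have Y0 : p.2 - Y v = 0.
  transitivity (- (- ((p.2 - Y v) * sin v) - (p.1 - X v) * cos v) * sin v
     + tangent_side v p * cos v); last by rewrite d0 pv; ring.
  by rewrite /tangent_side -[LHS]mulr1 -c1; ring.
by rewrite [p]surjective_pairing /c; congr pair; apply/eqP; rewrite -subr_eq0 ?X0 ?Y0.
Qed.

Lemma tangent_side_lipschitz v p q :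
  tangent_side v p - tangent_side v q <= 2 * `|p - q|.
Proof.
have n1 : `|p.1 - q.1| <= `|p - q| by rewrite prod_normE/= le_max lexx ?orbT.
have n2 : `|p.2 - q.2| <= `|p - q| by rewrite prod_normE/= le_max lexx ?orbT.
have -> : tangent_side v p - tangent_side v q =
    (p.2 - q.2) * cos v - (p.1 - q.1) * sin v by rewrite /tangent_side; ring.
apply: (le_trans (ler_norm _)); apply: (le_trans (ler_normB _ _)).
rewrite !normrM mulr_natl mulr2n lerD//.
  by rewrite (le_trans _ n2)// ler_piMr// cos_max.
by rewrite (le_trans _ n1)// ler_piMr// sin_max.
Qed.

(** By compactness of a period, the distances of an interior point to the tangent
    lines have a positive minimum. *)
Lemma open_left_region : open left_region.
Proof.
rewrite openE => p Kp; have cts (v : R) : {for v, continuous (tangent_side ^~ p)}.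
  exact: is_derive_continuous (is_derive_tangent_side v p).
have [|m _ min_m] := @EVT_min R (tangent_side ^~ p) 0 (2 * pi) (ltW pi2_gt0).
  exact: continuous_subspaceT.
have m0 := Kp m; rewrite /interior.
apply/nbhs_ballP; exists (tangent_side m p / 2); first by rewrite /= divr_gt0.
move=> q /=; rewrite -ball_normE/= => pq v.
have [v' [/andP[v0 v2] _ rep]] := periodic_representative 0 v (pi2_gt0 (R := R)).
rewrite -(rep _ (tangent_side ^~ q) (tangent_side_per ^~ q)).
have := min_m v'; rewrite in_itv/= v0 -[X in _ <= X]add0r ltW// => /(_ isT) mv'.
have := tangent_side_lipschitz v' p q.
lra.
Qed.

(** Off the curve this closed set coincides with the left region, which is thus
    relatively closed there. *)
Lemma closed_ge0_side : closed [set p | forall v, 0 <= tangent_side v p].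
Proof.
rewrite -[X in closed X]setCK; apply: open_closedC.
rewrite openE => p /= /existsNP[v /negP]; rewrite -ltNge => pv.
apply/nbhs_ballP; exists (- tangent_side v p / 2); first by rewrite /= divr_gt0// oppr_gt0.
move=> q /=; rewrite -ball_normE/= distrC => pq /(_ v).
by have := tangent_side_lipschitz v q p; lra.
Qed.

Lemma bounded_left_region : exists M, forall p, left_region p -> `|p| <= M.
Proof.
exists (`|X (pi / 2)| + `|X (- (pi / 2))| + `|Y 0| + `|Y pi|) => p Kp.
have := Kp 0; rewrite /tangent_side cos0 sin0 => K1.
have := Kp pi; rewrite /tangent_side cospi sinpi => K2.
have := Kp (pi / 2); rewrite /tangent_side cos_pihalf sin_pihalf => K3.
have := Kp (- (pi / 2)); rewrite /tangent_side cosN sinN cos_pihalf sin_pihalf => K4.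
have := ler_norm (X (pi / 2)); have := ler_norm (- X (- (pi / 2))).
have := ler_norm (- Y 0); have := ler_norm (Y pi); rewrite !normrN => n1 n2 n3 n4.
have := normr_ge0 (X (pi / 2)); have := normr_ge0 (X (- (pi / 2))).
have := normr_ge0 (Y 0); have := normr_ge0 (Y pi) => m1 m2 m3 m4.
by rewrite prod_normE/= ge_max !ler_norml; apply/andP; split; apply/andP; split; lra.
Qed.

(** The region is open and, in the complement of the curve, closed. *)
Lemma left_region_component p : left_region p ->
  connected_component (~` range c) p `<=` left_region.
Proof.
move=> Kp; set A := connected_component _ _.
have Ap : A p.
  apply: connected_component_refl => -[f _ fp].
  by have := Kp f; rewrite -fp tangent_side_self ltxx.
have := @component_connected _ (~` range c) p.
rewrite -/A => /(_ (A `&` left_region)) <-; first by move=> q [].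
- by exists p.
- by exists left_region => //; exact: open_left_region.
- exists [set p | forall v, 0 <= tangent_side v p]; first exact: closed_ge0_side.
  apply/seteqP; split => q [Aq Kq]; split => // v; first exact/ltW/Kq.
  rewrite lt_neqAle Kq andbT eq_sym; apply/eqP => qv.
  have : (~` range c) q by exact: connected_component_sub Aq.
  by apply; exists v => //; rewrite -(tangent_side0 Kq qv).
Qed.

(** From a point outside, move away along the normal of a tangent line that
    separates it from the curve. *)
Lemma unbounded_component p : ~ left_region p -> ~ range c p ->
  ~ bounded_set (connected_component (~` range c) p).
Proof.
move=> /existsNP[v /negP]; rewrite -leNgt => pv rp.
set A := connected_component _ _.
pose r s := (p.1 + s * sin v, p.2 - s * cos v).
have c1 := cos2Dsin2 v.
have rA s : 0 <= s -> A (r s).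
  move=> s0; have rconn : connected (r @` `[0, s]).
    apply: connected_continuous_connected; first exact: segment_connected.
    apply: continuous_subspaceT => x.
    have r1 : (fun t : R => p.1 + t * sin v) @ x --> p.1 + x * sin v.
      by apply: cvgD; [exact: cvg_cst|apply: cvgM; [exact: cvg_id|exact: cvg_cst]].
    have r2 : (fun t : R => p.2 - t * cos v) @ x --> p.2 - x * cos v.
      by apply: cvgB; [exact: cvg_cst|apply: cvgM; [exact: cvg_id|exact: cvg_cst]].
    exact: (cvg_pair r1 r2).
  suff sub : r @` `[0, s] `<=` A by apply: sub; exists s => //=; rewrite in_itv/= s0 lexx.
  apply: (connected_component_max _ _ rconn).
    exists 0; first by rewrite /= in_itv/= lexx s0.
    by rewrite /r !mul0r subr0 addr0 -surjective_pairing.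
  move=> _ [t tI <-] [f _ fr].
  have /andP[t0 _] : 0 <= t <= s by move: tI; rewrite /= in_itv.
  have tE : tangent_side v (r t) = tangent_side v p - t.
    transitivity (tangent_side v p - t * (cos v ^+ 2 + sin v ^+ 2)).
      by rewrite /r /tangent_side/=; ring.
    by rewrite c1 mulr1.
  have := tangent_side_curve_ge0 v f; rewrite fr tE => t1.
  have t00 : t = 0 by lra.
  by apply: rp; exists f => //; rewrite fr t00 /r !mul0r subr0 addr0 -surjective_pairing.
move=> [N [_ bN]]; pose M := N + 1.
have bA q : A q -> `|q| <= M by apply: bN; rewrite ltrDl.
pose s := 2 * `|M| + `|p.1| + `|p.2| + 1.
have s0 : 0 <= s by rewrite !addr_ge0 ?mulr_ge0.
have := bA _ (rA s s0); rewrite prod_normE/= ge_max => /andP[r1 r2].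
have sE : s = (r s).1 * sin v - (r s).2 * cos v - p.1 * sin v + p.2 * cos v.
  by rewrite /= -[LHS]mulr1 -c1; ring.
have le_sin (x : R) : `|x * sin v| <= `|x| by rewrite normrM ler_piMr// sin_max.
have le_cos (x : R) : `|x * cos v| <= `|x| by rewrite normrM ler_piMr// cos_max.
have := le_sin (r s).1; have := le_cos (r s).2; have := le_sin p.1; have := le_cos p.2.
rewrite !ler_norml => /andP[_ a1] /andP[a2 _] /andP[a3 _] /andP[_ a4].
have := ler_norm M; move: sE {rA bA}; rewrite {1}/s /=; move: r1 r2 a3 a4 => /=.
lra.
Qed.

Lemma enclosed_left_region (g : R -> R * R) : range g = range c -> enclosed g = left_region.
Proof.
move=> gc; rewrite /enclosed gc; apply/seteqP; split => p /=.
  by move=> [rp bp]; apply/not_notP => Kp; exact: unbounded_component bp.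
move=> Kp; split.
  by move=> [f _ fp]; have := Kp f; rewrite -fp tangent_side_self ltxx.
have [M bM] := bounded_left_region; exists M; split; first exact: num_real.
move=> x Mx q Aq /=; apply: (le_trans (bM _ _) (ltW Mx)).
exact: left_region_component Aq.
Qed.

End ConvexRegion.

(** * The area of the enclosed region *)

Section RegionArea.
Context {R : realType}.
Variables X Y rho : R -> R.
Hypothesis XY : angle_param X Y rho.
Hypothesis perX : forall f, X (f + 2 * pi) = X f.
Hypothesis perY : forall f, Y (f + 2 * pi) = Y f.

Let p2 : R := pi / 2.

Let slice_oo (a b x : R) : - p2 < a < p2 -> p2 < b < pi + p2 -> X a = x -> X b = x ->
  xsection (left_region X Y) x = `]Y a, Y b[%classic.
Proof.
move=> /andP[a1 a2] /andP[b1 b2] Xa Xb.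
have cosa : 0 < cos a by rewrite cos_gt0_pihalf// a1.
have cosb : cos b < 0.
  rewrite -[b](subrK pi) cosDpi oppr_lt0 cos_gt0_pihalf//.
  by move: b1 b2; rewrite /p2 => b1 b2; apply/andP; split; lra.
apply/seteqP; split => y; rewrite /xsection/= in_itv/= inE => K.
  have := K a; have := K b; rewrite /tangent_side/= Xa Xb !subrr !mul0r !subr0.
  by rewrite nmulr_lgt0// subr_lt0 pmulr_lgt0// subr_gt0 => -> ->.
move=> v; have /andP[Ya Yb] := K.
have Yab : 0 < Y b - Y a by rewrite subr_gt0 (lt_trans Ya).
pose w := (y - Y a) / (Y b - Y a).
have w0 : 0 < w by rewrite divr_gt0// subr_gt0.
have w1 : 0 < 1 - w by rewrite subr_gt0 ltr_pdivrMr// mul1r ltrD2r.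
have -> : tangent_side X Y v (x, y) =
    w * tangent_side X Y v (X b, Y b) + (1 - w) * tangent_side X Y v (X a, Y a).
  have yE : y = w * Y b + (1 - w) * Y a.
    transitivity (w * (Y b - Y a) + Y a); last by ring.
    by rewrite divfK ?gt_eqF// subrK.
  by rewrite /tangent_side/= Xa Xb {1}yE; ring.
have A0 := tangent_side_curve_ge0 XY perX perY v a.
have B0 := tangent_side_curve_ge0 XY perX perY v b.
(* A tangent line touches the curve at one point only, hence not at both ends of the slice. *)
have [v' [/andP[v1 v2] _ rep]] := periodic_representative (- p2) v (pi2_gt0 (R := R)).
have sideE p : tangent_side X Y v p = tangent_side X Y v' p.
  by rewrite (rep _ (tangent_side X Y ^~ p))// => z; exact: tangent_side_per.
rewrite !sideE in A0 B0 *.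
have [va|av] := ltP v' b.
  rewrite ltr_wpDr// ?(mulr_ge0 (ltW w1))// mulr_gt0//.
  by apply: tangent_side_curve_gt0 XY perX perY _ _ _; move: v1 b2 va; rewrite /p2; lra.
rewrite ltr_wpDl// ?(mulr_ge0 (ltW w0))// mulr_gt0//.
have := @tangent_side_curve_gt0 _ _ _ _ XY perX perY v' (a + 2 * pi).
by rewrite perX perY; apply; move: a1 a2 b1 b2 v1 v2 av; rewrite /p2; lra.
Qed.

Let slice_out (x : R) : (x <= X (- p2)) || (X p2 <= x) -> xsection (left_region X Y) x = set0.
Proof.
move=> xout; apply/seteqP; split => // y; rewrite /xsection/= inE => K.
have := K p2; have := K (- p2); rewrite /tangent_side/= cosN sinN cos_pihalf sin_pihalf.
by move: xout => /orP[]; lra.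
Qed.

(** With [a x] and [b' x] the angles of the lower and upper points of abscissa
    [x], the slice length [Y (b' x) - Y (a x)] has primitive
    [Q (b' x) - Q (a x)], since [Q'] and [X'] have quotient [Y].  The two angles
    agree at the right end and differ by a full turn at the left end. *)
Lemma area_left_region (Q : R -> R) :
  (forall f : R, is_derive f 1 Q (Y f * (rho f * cos f))) ->
  ((@lebesgue_measure R \x @lebesgue_measure R) (left_region X Y)
    = (Q (- (pi / 2)) - Q (pi + pi / 2))%:E)%E.
Proof.
move=> dQ; rewrite -/p2; have pi0 := pi_gt0 R.
have p2E : p2 + p2 = pi by rewrite /p2; lra.
have p20 : 0 < p2 by rewrite /p2; lra.
have Np2 : - p2 < p2 by lra.
have XY' := angle_param_rot pi XY.
have [a [ca aX Xa da]] := segment_inverse Np2 (angleX_derive XY) (angleX_gt0 XY).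
have [b [cb bX Xb db]] := segment_inverse Np2 (angleX_derive XY') (angleX_gt0 XY').
have X3 : X (p2 + pi) = X (- p2) by rewrite -(perX (- p2)); congr X; lra.
have Y3 : Y (p2 + pi) = Y (- p2) by rewrite -(perY (- p2)); congr Y; lra.
have rot1 : rotX X Y pi (- p2) = - X p2 by rewrite rotX_pi; congr (- X _); lra.
have rot2 : rotX X Y pi p2 = - X (- p2) by rewrite rotX_pi X3.
rewrite rot1 rot2 in Xb db.
pose b' x := b (- x) + pi.
pose h x := Y (b' x) - Y (a x).
have Xlt : X (- p2) < X p2 by exact: angleX_incr XY _ _ _ _ _.
have cb' : continuous b'.
  move=> x; apply: cvgD; last exact: cvg_cst.
  by apply: (@continuous_comp _ _ _ (fun h : R => - h) b); [exact: opp_continuous|exact: cb].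
have cY (f : R) : {for f, continuous Y} := is_derive_continuous (angleY_derive XY f).
have cQ (f : R) : {for f, continuous Q} := is_derive_continuous (dQ f).
have ch : continuous h.
  move=> x; apply: cvgB; first by apply: continuous_comp; [exact: cb'|exact: cY].
  by apply: continuous_comp; [exact: ca|exact: cY].
have sliceE x : X (- p2) < x < X p2 -> [/\ - p2 < a x < p2, p2 < b' x < pi + p2,
    X (a x) = x & X (b' x) = x].
  move=> /andP[x1 x2].
  have [|/andP[a1 a2] Xax] := Xa x; first by rewrite !ltW.
  have [|/andP[b1 b2]] := Xb (- x); first by rewrite !lerN2 !ltW.
  rewrite rotX_pi -/(b' x) => /oppr_inj Xbx; split => //.
    rewrite !lt_neqAle a1 a2 !andbT; apply/andP; split; apply/eqP => E.
      by move: x1; rewrite -Xax -E ltxx.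
    by move: x2; rewrite -Xax E ltxx.
  apply/andP; split; rewrite lt_neqAle; apply/andP; split.
  - by apply/eqP => E; move: x2; rewrite -Xbx -E ltxx.
  - by rewrite /b'; lra.
  - by apply/eqP => E; move: x1; rewrite -Xbx E addrC X3 ltxx.
  - by rewrite /b'; lra.
have a1 : a (X (- p2)) = - p2 by rewrite aX// lexx ltW.
have a2 : a (X p2) = p2 by rewrite aX// lexx ltW.
have b1 : b' (X (- p2)) = p2 + pi by rewrite /b' -rot2 bX// lexx ltW.
have b2 : b' (X p2) = p2 by rewrite /b' -rot1 bX ?lexx ?ltW//; lra.
rewrite /product_measure1.
have -> : (lebesgue_measure \o xsection (left_region X Y))%E =
    ((EFin \o h) \_ `[X (- p2), X p2])%E.
  apply/funext => x /=; rewrite patchE mem_setE in_itv/=.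
  have [xin|xout] := boolP (X (- p2) < x < X p2).
    have [ax bx Xax Xbx] := sliceE x xin; rewrite (slice_oo ax bx Xax Xbx).
    move: (xin) => /andP[x1 x2]; rewrite !ltW//= lebesgue_measure_itv/= lte_fin.
    suff -> : Y (a x) < Y (b' x) by rewrite EFinB.
    have cosa : 0 < cos (a x) by rewrite cos_gt0_pihalf.
    have := @tangent_side_curve_gt0 _ _ _ _ XY perX perY (a x) (b' x).
    rewrite /tangent_side/= Xax Xbx subrr mul0r subr0 pmulr_lgt0// subr_gt0; apply.
    by move: ax bx => /andP[? ?] /andP[? ?]; lra.
  rewrite slice_out; last by move: xout; rewrite negb_and -!leNgt.
  rewrite measure0; case: ifPn => // /andP[x1 x2].
  have [->|->] : x = X (- p2) \/ x = X p2.
    by move: xout; rewrite negb_and -!leNgt => /orP[?|?]; [left|right]; lra.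
    by rewrite /h a1 b1 Y3 subrr.
  by rewrite /h a2 b2 subrr.
have dF (x : R) : X (- p2) < x < X p2 -> is_derive x 1 (fun x => Q (b' x) - Q (a x)) (h x).
  move=> xin; have [ax bx _ _] := sliceE x xin; have /andP[x1 x2] := xin.
  have xin' : - X p2 < - x < - X (- p2) by rewrite !ltrN2 x2.
  have dNb := is_derive_chain (g := fun t => - t) (db _ xin')
    (is_derive_opp (is_derive_id x (1 : R))).
  have db' := is_derive_add dNb (is_derive_const pi x).
  apply: is_derive_eq (is_derive_sub (is_derive_chain (g := b') (dQ (b' x)) db')
    (is_derive_chain (g := a) (dQ (a x)) (da x xin))) _.
  have [ra _ _] := XY (a x); have [rb _ _] := XY (b' x).
  have cosa : cos (a x) != 0 by rewrite gt_eqF// cos_gt0_pihalf.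
  have cosb : cos (b (- x)) != 0.
    by rewrite gt_eqF// cos_gt0_pihalf//; move: bx; rewrite /b' -/p2 => /andP[? ?]; lra.
  rewrite /h {3}/b' cosDpi -/(b' x); move: (cos (b (- x))) cosb => cb0 cb0_neq0.
  by field; rewrite cosa cb0_neq0 !gt_eqF.
rewrite -integral_mkcond (@continuous_FTC2 _ h (fun x => Q (b' x) - Q (a x)))//.
- rewrite a1 a2 b1 b2 subrr -EFinB sub0r opprB; congr (_ - Q _)%:E; lra.
- exact: continuous_subspaceT.
- have cF : continuous (fun x => Q (b' x) - Q (a x)).
    move=> x; apply: cvgB; first by apply: continuous_comp; [exact: cb'|exact: cQ].
    by apply: continuous_comp; [exact: ca|exact: cQ].
  split; [|exact/cvg_at_right_filter/cF|exact/cvg_at_left_filter/cF].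
  by move=> x; rewrite in_itv/= => /dF dFx; exact: ex_derive.
- by move=> x; rewrite in_itv/= => /dF dFx; rewrite derive1E; exact: derive_val.
Qed.
End RegionArea.

(** * Derivatives of plane-valued functions and angles of unit vectors *)

Section Plane.
Context {R : realType}.

Lemma is_derive_fst (V : normedModType R) (f : V -> R * R) (x v : V) (d : R * R) :
  is_derive x v f d -> is_derive x v (fun t => (f t).1) d.1.
Proof.
move=> [fx <-]; have C : (fun h => (h^-1 *: (f (h *: v + x) - f x)).1) @ 0^' --> ('D_v f x).1.
  by apply: (@cvg_comp _ _ _ _ (fun p : R * R => p.1) _ (nbhs ('D_v f x))); [exact: fx|exact: cvg_fst].
apply: DeriveDef; first by apply/cvg_ex; exists ('D_v f x).1; exact: C.
exact: (cvg_lim _ C).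
Qed.

Lemma is_derive_snd (V : normedModType R) (f : V -> R * R) (x v : V) (d : R * R) :
  is_derive x v f d -> is_derive x v (fun t => (f t).2) d.2.
Proof.
move=> [fx <-]; have C : (fun h => (h^-1 *: (f (h *: v + x) - f x)).2) @ 0^' --> ('D_v f x).2.
  by apply: (@cvg_comp _ _ _ _ (fun p : R * R => p.2) _ (nbhs ('D_v f x))); [exact: fx|exact: cvg_snd].
apply: DeriveDef; first by apply/cvg_ex; exists ('D_v f x).2; exact: C.
exact: (cvg_lim _ C).
Qed.

Lemma is_derive_pair (V : normedModType R) (f g : V -> R) (x v : V) (a b : R) :
  is_derive x v f a -> is_derive x v g b -> is_derive x v (fun t => (f t, g t)) (a, b).
Proof.
move=> [fx <-] [gx <-].
have C : (fun h => h^-1 *: ((f (h *: v + x), g (h *: v + x)) - (f x, g x))) @ 0^'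
    --> ('D_v f x, 'D_v g x) by exact: (cvg_pair fx gx).
apply: DeriveDef; first by apply/cvg_ex; exists ('D_v f x, 'D_v g x); exact: C.
exact: (cvg_lim _ C).
Qed.

Lemma derive1_periodic (W : normedModType R) (f : R -> W) (T u : R) :
  (forall x, f (x + T) = f x) -> derive1 f (u + T) = derive1 f u.
Proof.
move=> fT; rewrite /derive1 fT.
suff -> : (fun h => h^-1 *: (f (h + (u + T)) - f u)) = (fun h => h^-1 *: (f (h + u) - f u)).
  by [].
by apply/funext => h; rewrite addrA fT.
Qed.

Lemma unit_angle (a b : R) : a ^+ 2 + b ^+ 2 = 1 -> exists t, cos t = a /\ sin t = b.
Proof.
move=> ab; have a1 : -1 <= a <= 1.
  by rewrite -ler_norml -(@ler_pXn2r _ 2) ?nnegrE// real_normK ?num_real// expr1n -ab lerDl sqr_ge0.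
have b2 : Num.sqrt (1 - a ^+ 2) = `|b| by rewrite -ab addrC addKr sqrtr_sqr.
have [b0|b0] := lerP 0 b.
  by exists (acos a); rewrite acosK ?in_itv//= sin_acos// b2 ger0_norm.
exists (- acos a); rewrite cosN sinN acosK ?in_itv//= sin_acos// b2 ltr0_norm//.
by rewrite opprK.
Qed.

Lemma cos_eq1 (x : R) : 0 < x -> cos x = 1 -> exists2 m : nat, (0 < m)%N & x = m%:R * (2 * pi).
Proof.
move=> x0; have [y [/andP[y0 y2] [k yE] rep]] := periodic_representative 0 x (pi2_gt0 (R := R)).
rewrite -(rep _ _ cos_per) => cosy.
have y00 : y = 0.
  apply/eqP; rewrite eq_le y0 andbT leNgt; apply/negP => ygt0.
  have : 0 < sin (y / 2) by apply: sin_gt0_pi; rewrite divr_gt0//=; lra.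
  have yE2 : y / 2 *+ 2 = y by rewrite -mulr_natr divfK.
  have := cos_mulr2n (y / 2); rewrite yE2 cosy cos2sin2 => E s0.
  have : 0 < sin (y / 2) ^+ 2 by rewrite exprn_gt0.
  by move: E; rewrite -mulr_natr; lra.
have xE : x = k%:~R * (2 * pi) by move: yE; rewrite y00; lra.
have : 0 < k by move: x0; rewrite xE pmulr_lgt0 ?pi2_gt0// ltr0z.
by case: k xE {yE} => // m xE m0; exists m.
Qed.

(** Rotating [(p, q)] back by a primitive of its turning rate [k] makes it constant. *)
Lemma turning_angle (p q k : R -> R) :
  (forall u : R, is_derive u 1 p (- (k u * q u))) ->
  (forall u : R, is_derive u 1 q (k u * p u)) ->
  continuous k -> p 0 ^+ 2 + q 0 ^+ 2 = 1 ->
  exists th : R -> R, (forall u : R, is_derive u 1 th (k u)) /\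
    forall u, p u = cos (th u) /\ q u = sin (th u).
Proof.
move=> dp dq ck pq1; have [t0 [cost sint]] := unit_angle pq1.
have [F dF] := primitive_exists ck.
pose th u := F u + (t0 - F 0).
have dth (u : R) : is_derive u 1 th (k u).
  by apply: is_derive_eq (is_derive_add (dF u) (is_derive_const _ u)) _; rewrite addr0.
exists th; split => // u.
have dc (v : R) := is_derive_chain (g := th) (is_derive_cos (th v)) (dth v).
have ds (v : R) := is_derive_chain (g := th) (is_derive_sin (th v)) (dth v).
have th0 : th 0 = t0 by rewrite /th addrC subrK.
have P1 : p u * cos (th u) + q u * sin (th u) = 1.
  transitivity (p 0 * cos (th 0) + q 0 * sin (th 0)); last by rewrite th0 cost sint -!expr2.
  apply: (@is_derive_0_is_cst _ (fun v => p v * cos (th v) + q v * sin (th v))) => v.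
  apply: is_derive_eq (is_derive_add (is_derive_mul (dp v) (dc v))
    (is_derive_mul (dq v) (ds v))) _; ring.
have M0 : q u * cos (th u) - p u * sin (th u) = 0.
  transitivity (q 0 * cos (th 0) - p 0 * sin (th 0)).
    apply: (@is_derive_0_is_cst _ (fun v => q v * cos (th v) - p v * sin (th v))) => v.
    apply: is_derive_eq (is_derive_sub (is_derive_mul (dq v) (dc v))
      (is_derive_mul (dp v) (ds v))) _; ring.
  by rewrite th0 cost sint mulrC subrr.
have c1 := cos2Dsin2 (th u); split.
  transitivity ((p u * cos (th u) + q u * sin (th u)) * cos (th u)
     - (q u * cos (th u) - p u * sin (th u)) * sin (th u)); last by rewrite P1 M0; ring.
  by rewrite -[LHS]mulr1 -c1; ring.
transitivity ((p u * cos (th u) + q u * sin (th u)) * sin (th u)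
   + (q u * cos (th u) - p u * sin (th u)) * cos (th u)); last by rewrite P1 M0; ring.
by rewrite -[LHS]mulr1 -c1; ring.
Qed.

End Plane.

(** * Frenet formulas *)

Section SmoothCurve.
Context {R : realType}.
Variable c : R -> R * R.
Hypothesis c_smooth : smooth_on [set: R] c.
Hypothesis c_regular : forall u : R, derive1 c u != 0.

Let c1 := derive1 c.
Let c2 := derive1 c1.

Lemma curve_derive (u : R) : is_derive u 1 c (derive1 c u).
Proof.
apply: DeriveDef; first by apply: diff_derivable; exact: (c_smooth [::] I).
by rewrite derive1E.
Qed.

Let derive1_D (f : R -> R * R) : derive1 f = 'D_1 f.
Proof. by apply/funext => u; rewrite derive1E. Qed.

Lemma curve_derive1 (u : R) : is_derive u 1 (derive1 c) (derive1 (derive1 c) u).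
Proof.
apply: DeriveDef; last by rewrite derive1E.
by apply: diff_derivable; rewrite derive1_D; exact: (c_smooth [:: 1] I).
Qed.

Lemma curve_derive2_continuous : continuous (derive1 (derive1 c)).
Proof.
move=> u; apply: differentiable_continuous; rewrite !derive1_D.
exact: (c_smooth [:: 1; 1] I).
Qed.

Lemma speed_sqr u : speed c u ^+ 2 = (c1 u).1 ^+ 2 + (c1 u).2 ^+ 2.
Proof. by rewrite sqr_sqrtr /dotp ?expr2// addr_ge0// sqr_ge0. Qed.

Lemma speed_sqr_gt0 u : 0 < (c1 u).1 ^+ 2 + (c1 u).2 ^+ 2.
Proof.
rewrite lt_neqAle addr_ge0 ?sqr_ge0// andbT eq_sym paddr_eq0 ?sqr_ge0// !sqrf_eq0.
apply/negP => /andP[/eqP p0 /eqP q0]; have /eqP := c_regular u.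
by apply; rewrite -/c1 [c1 u]surjective_pairing p0 q0.
Qed.

Lemma speed_gt0 u : 0 < speed c u.
Proof. by rewrite sqrtr_gt0 /dotp -!expr2 speed_sqr_gt0. Qed.

Lemma is_derive_speed (u : R) : is_derive u 1 (speed c)
  (((c1 u).1 * (c2 u).1 + (c1 u).2 * (c2 u).2) / speed c u).
Proof.
have dp := is_derive_fst (curve_derive1 u); have dq := is_derive_snd (curve_derive1 u).
have s0 := speed_gt0 u.
have n0 : 0 < (c1 u).1 * (c1 u).1 + (c1 u).2 * (c1 u).2 by rewrite -!expr2 speed_sqr_gt0.
have := is_derive_chain (g := fun u => (c1 u).1 * (c1 u).1 + (c1 u).2 * (c1 u).2)
  (is_derive1_sqrt n0) (is_derive_add (is_derive_mul dp dp) (is_derive_mul dq dq)).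
move=> D; apply: is_derive_eq D _.
have E (a b d e s : R) : 0 < s ->
    (2 * s)^-1 * (d * a + a * d + (e * b + b * e)) = (a * d + b * e) / s.
  by move=> s0'; field; rewrite gt_eqF.
exact: E.
Qed.

Lemma speed_continuous : continuous (speed c).
Proof. by move=> u; exact: is_derive_continuous (is_derive_speed u). Qed.

(** The product of curvature and speed, in a form that is visibly continuous. *)
Definition turning_rate u := ((c1 u).1 * (c2 u).2 - (c1 u).2 * (c2 u).1) / speed c u ^+ 2.

Lemma tangentE u : tangent c u = ((c1 u).1 / speed c u, (c1 u).2 / speed c u).
Proof.
rewrite /tangent /arc_derive -/c1 [X in _ *: X]surjective_pairing.
by congr pair; rewrite /= /GRing.scale/= mulrC.
Qed.

(** Together with [is_derive_tangent2]: the unit tangent rotates at the rate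
    [turning_rate]. *)
Lemma is_derive_tangent1 (u : R) : is_derive u 1 (fun u => (tangent c u).1)
  (- (turning_rate u * (tangent c u).2)).
Proof.
have s0 := speed_gt0 u; have s0' : speed c u != 0 by rewrite gt_eqF.
have dp := is_derive_fst (curve_derive1 u).
have dV := is_deriveV s0' (is_derive_speed u).
rewrite (_ : (fun u => (tangent c u).1) = fun u => (c1 u).1 * (speed c u)^-1); last first.
  by apply/funext => v; rewrite tangentE.
apply: is_derive_eq (is_derive_mul dp dV) _.
rewrite /turning_rate tangentE /GRing.scale/= -/c2.
have E (a b d e s : R) : s != 0 -> s ^+ 2 = a ^+ 2 + b ^+ 2 ->
    d / s + a * (- s ^- 2 * ((a * d + b * e) / s)) = - ((a * e - b * d) / s ^+ 2 * (b / s)).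
  move=> sn0 sE; transitivity (d * (a ^+ 2 + b ^+ 2) / s ^+ 2 / s - a * (a * d + b * e) / s ^+ 3).
    by rewrite -sE; field.
  by field.
exact: E (speed_sqr u).
Qed.

Lemma is_derive_tangent2 (u : R) : is_derive u 1 (fun u => (tangent c u).2)
  (turning_rate u * (tangent c u).1).
Proof.
have s0 := speed_gt0 u; have s0' : speed c u != 0 by rewrite gt_eqF.
have dp := is_derive_snd (curve_derive1 u).
have dV := is_deriveV s0' (is_derive_speed u).
rewrite (_ : (fun u => (tangent c u).2) = fun u => (c1 u).2 * (speed c u)^-1); last first.
  by apply/funext => v; rewrite tangentE.
apply: is_derive_eq (is_derive_mul dp dV) _.
rewrite /turning_rate tangentE /GRing.scale/= -/c2.
have E (a b d e s : R) : s != 0 -> s ^+ 2 = a ^+ 2 + b ^+ 2 ->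
    e / s + b * (- s ^- 2 * ((a * d + b * e) / s)) = (a * e - b * d) / s ^+ 2 * (a / s).
  move=> sn0 sE; transitivity (e * (a ^+ 2 + b ^+ 2) / s ^+ 2 / s - b * (a * d + b * e) / s ^+ 3).
    by rewrite -sE; field.
  by field.
exact: E (speed_sqr u).
Qed.

Lemma tangent_unit u : (tangent c u).1 ^+ 2 + (tangent c u).2 ^+ 2 = 1.
Proof.
by rewrite tangentE/= !expr_div_n -mulrDl -speed_sqr divff// sqrf_eq0 gt_eqF// speed_gt0.
Qed.

Lemma curvature_speed u : curvature c u * speed c u = turning_rate u.
Proof.
have s0 : speed c u != 0 by rewrite gt_eqF// speed_gt0.
have := is_derive_pair (is_derive_tangent1 u) (is_derive_tangent2 u).
rewrite (_ : (fun _ => _) = tangent c); last first.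
  by apply/funext => v; rewrite -surjective_pairing.
move=> dT; rewrite /curvature /arc_derive derive1E (@derive_val _ _ _ _ _ _ _ dT).
rewrite /normal /rot90 /dotp /= /GRing.scale/= -[RHS]mulr1 -(tangent_unit u).
have E (k a b s : R) : s != 0 ->
    (s^-1 * - (k * b) * - b + s^-1 * (k * a) * a) * s = k * (a ^+ 2 + b ^+ 2).
  by move=> sn0; field.
exact: E.
Qed.

Lemma turning_rate_continuous : continuous turning_rate.
Proof.
move=> u; have cp := is_derive_continuous (is_derive_fst (curve_derive1 u)).
have cq := is_derive_continuous (is_derive_snd (curve_derive1 u)).
have c2u : {for u, continuous c2} := @curve_derive2_continuous u.
have cp2 : {for u, continuous (fun u => (c2 u).1)}.
  by apply: (@cvg_comp _ _ _ c2 (fun p : R * R => p.1) _ (nbhs (c2 u))); [exact: c2u|exact: cvg_fst].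
have cq2 : {for u, continuous (fun u => (c2 u).2)}.
  by apply: (@cvg_comp _ _ _ c2 (fun p : R * R => p.2) _ (nbhs (c2 u))); [exact: c2u|exact: cvg_snd].
apply: cvgM; first by apply: cvgB; [exact: cvgM cp cq2|exact: cvgM cq cp2].
apply: cvgV; first by rewrite sqrf_eq0 gt_eqF// speed_gt0.
exact: (continuous_comp (@speed_continuous u) (@exprn_continuous R 2 _)).
Qed.

Hypothesis c_periodic : forall u, c (u + 1) = c u.

Lemma speed_periodic u : speed c (u + 1) = speed c u.
Proof. by rewrite /speed derive1_periodic. Qed.

Lemma turning_rate_periodic u : turning_rate (u + 1) = turning_rate u.
Proof.
have c1p v : c1 (v + 1) = c1 v by exact: derive1_periodic.
by rewrite /turning_rate speed_periodic c1p /c2 derive1_periodic.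
Qed.

Lemma tangent_periodic u : tangent c (u + 1) = tangent c u.
Proof. by rewrite !tangentE speed_periodic /c1 derive1_periodic. Qed.

End SmoothCurve.

(** * Convex curves in the tangent angle parameter *)

Section ConvexCurve.
Context {R : realType}.

(** The increments over the integers make [th] unbounded in both directions,
    hence onto. *)
Lemma quasiperiodic_inverse (th k : R -> R) (T : R) :
  (forall u : R, is_derive u 1 th (k u)) -> (forall u, 0 < k u) ->
  (forall u, th (u + 1) = th u + T) ->
  exists tau : R -> R, [/\ cancel th tau, cancel tau th &
    forall f : R, is_derive f 1 tau (k (tau f))^-1].
Proof.
move=> dth k0 perth.
have incr u v : u < v -> th u < th v.
  by move=> uv; apply: (derive_gt0_incr (a := u) (b := v) dth).
have T0 : 0 < T by have := incr 0 1 ltr01; rewrite -[1]add0r perth ltrDl.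
have cth u : {for u, continuous th} := is_derive_continuous (dth u).
have pern u (n : nat) : th (u + n%:R) = th u + n%:R * T.
  elim: n => [|n IH]; first by rewrite mul0r !addr0.
  by rewrite -addn1 !natrD addrA perth IH; ring.
have /choice[tau thtau] f : exists u, th u = f.
  pose n := Num.bound (`|f - th 0| / T).
  have nP : `|f - th 0| < n%:R * T by rewrite -ltr_pdivrMr// archi_boundP// divr_ge0// ltW.
  have th1 : th n%:R = th 0 + n%:R * T by rewrite -pern add0r.
  have th2 : th (- n%:R) = th 0 - n%:R * T by rewrite -[in RHS](addNr n%:R) pern addrK.
  have n0 : 0 <= n%:R * T by rewrite mulr_ge0// ltW.
  move: nP; rewrite ltr_norml => /andP[f1 f2].
  have [|||u _ uf] := @IVT R th (- n%:R) n%:R f.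
  - by rewrite (@le_trans _ _ 0)// oppr_le0.
  - exact: continuous_subspaceT.
  - by rewrite th1 th2 min_l ?max_r; lra.
  by exists u.
have tauth u : tau (th u) = u.
  have := thtau (th u); have [/incr lt E|/incr lt E|//] := ltgtP (tau (th u)) u;
    by move: lt; rewrite E ltxx.
exists tau; split => // f.
have := @is_derive_inverse R th tau (k (tau f)) (tau f); rewrite thtau; apply.
- by near=> u; exact: tauth.
- by near=> u; exact: cth.
- by rewrite gt_eqF.
Unshelve. all: by end_near. Qed.

Variable c : R -> R * R.
Hypothesis cvx : convex_curve c.

Let smooth := convex_smooth cvx.
Let regular := convex_regular cvx.
Let periodic := convex_periodic cvx.

Lemma turning_rate_gt0 u : 0 < turning_rate c u.
Proof.
by rewrite -curvature_speed// mulr_gt0 ?speed_gt0//; exact: convex_curvature_gt0.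
Qed.

(** Simplicity on the fundamental interval, spread over the line by periodicity. *)
Lemma convex_injective u v : u < v -> v < u + 1 -> c u <> c v.
Proof.
move=> uv vu cuv.
have [u' [u01 [j uE] repu]] := periodic_representative 0 u (@ltr01 R).
have [v' [v01 [k vE] repv]] := periodic_representative 0 v (@ltr01 R).
rewrite add0r in u01 v01.
have uv' : u' = v' by apply: (convex_simple cvx) => //; rewrite repu ?repv.
have E : (k - j)%:~R = v - u by rewrite intrB; lra.
have : 0 < k - j < 1 by rewrite -(ltr0z R) -(ltrz1 R) E; apply/andP; split; lra.
by rewrite gtz0_ge1 => /andP[j1 j2]; have := le_lt_trans j1 j2; rewrite ltxx.
Qed.

(** The tangent angle can serve as parameter: it increases at the rate of curvature,
    and its total increase is a single turn because the curve is simple. *)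
Lemma convex_angle_param : exists th tau : R -> R,
  [/\ forall u : R, is_derive u 1 th (curvature c u * speed c u),
      forall u, th (u + 1) = th u + 2 * pi,
      cancel th tau /\ cancel tau th,
      forall f : R, is_derive f 1 tau (turning_rate c (tau f))^-1 &
      angle_param (fun f => (c (tau f)).1) (fun f => (c (tau f)).2)
        (fun f => speed c (tau f) / turning_rate c (tau f))].
Proof.
have [th [dth thE]] := turning_angle (is_derive_tangent1 smooth regular)
  (is_derive_tangent2 smooth regular) (turning_rate_continuous smooth regular)
  (tangent_unit regular 0).
have k0 := turning_rate_gt0.
pose T := th 1 - th 0.
have perT u : th (u + 1) = th u + T.
  suff <- : th (u + 1) - th u = T by rewrite [RHS]addrC subrK.
  transitivity (th (0 + 1) - th 0); last by rewrite add0r.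
  apply: (@is_derive_0_is_cst _ (fun u => th (u + 1) - th u)) => v.
  apply: is_derive_eq (is_derive_sub (is_derive_shift (dth (v + 1))) (dth v)) _.
  by rewrite turning_rate_periodic// subrr.
have T0 : 0 < T.
  by rewrite subr_gt0; apply: (derive_gt0_incr (a := 0) (b := 1) dth).
have [tau [tauth thtau dtau]] := quasiperiodic_inverse dth k0 perT.
have perT2 f : tau (f + T) = tau f + 1.
  by rewrite -[in LHS](thtau f) -perT tauth.
have ap : angle_param (fun f => (c (tau f)).1) (fun f => (c (tau f)).2)
    (fun f => speed c (tau f) / turning_rate c (tau f)).
  move=> f; have [c1 s1] := thE (tau f); have s0 := speed_gt0 regular (tau f).
  rewrite tangentE thtau /= in c1 s1; split.
  - by rewrite divr_gt0// speed_gt0.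
  - apply: is_derive_eq (is_derive_chain (f := fun u => (c u).1) (g := tau)
      (is_derive_fst (curve_derive smooth (tau f))) (dtau f)) _.
    by rewrite -c1 /=; field; rewrite !gt_eqF.
  - apply: is_derive_eq (is_derive_chain (f := fun u => (c u).2) (g := tau)
      (is_derive_snd (curve_derive smooth (tau f))) (dtau f)) _.
    by rewrite -s1 /=; field; rewrite !gt_eqF.
have [m m0 Tm] : exists2 m : nat, (0 < m)%N & T = m%:R * (2 * pi).
  apply: cos_eq1 => //; rewrite /T cosB.
  have [c1 s1] := thE 1; have [c0 s0] := thE 0.
  have t1 : tangent c 1 = tangent c 0 by rewrite -[1 in LHS]add0r tangent_periodic.
  rewrite -c1 -s1 -c0 -s0 t1 -!expr2.
  exact: tangent_unit.
have m1 : m = 1%N.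
  apply: (turning_once ap m0); rewrite -Tm.
  - by move=> f; rewrite perT2 periodic.
  - by move=> f; rewrite perT2 periodic.
  - move=> f g fg gf X12 Y12.
    have incr u v : u < v -> tau u < tau v.
      by move=> uv; apply: (derive_gt0_incr (a := u) (b := v) dtau) => // x _; rewrite invr_gt0.
    apply: (@convex_injective (tau f) (tau g)); [exact: incr|by rewrite -perT2 incr|].
    by rewrite [c (tau f)]surjective_pairing X12 Y12 -surjective_pairing.
exists th, tau; split => //.
- by move=> u; rewrite curvature_speed.
- by move=> u; rewrite perT Tm m1 mul1r.
Qed.

End ConvexCurve.

(** * Area, total curvature and length of a convex curve *)

Section ConvexIntegrals.
Context {R : realType}.
Variable c : R -> R * R.
Hypothesis cvx : convex_curve c.

Let smooth := convex_smooth cvx.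
Let regular := convex_regular cvx.
Let periodic := convex_periodic cvx.

Lemma curvature_continuous : continuous (curvature c).
Proof.
have -> : curvature c = fun u => turning_rate c u * (speed c u)^-1.
  by apply/funext => u; rewrite -curvature_speed// mulfK// gt_eqF// speed_gt0.
move=> u; apply: cvgM; first exact: turning_rate_continuous.
by apply: cvgV; [rewrite gt_eqF// speed_gt0|exact: speed_continuous].
Qed.

Lemma total_curvature : arc_integral c (curvature c) = 2 * pi.
Proof.
have [th [_ [dth perth _ _ _]]] := convex_angle_param cvx.
rewrite /arc_integral (Rintegral_primitive (f := th))//; last first.
  by move=> u; apply: cvgM; [exact: curvature_continuous|exact: speed_continuous].
by have := perth 0; rewrite add0r => ->; rewrite addrC addKr.
Qed.

(** Green's formula [A = - \int y dx]; a primitive stands for the integral, so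
    that a change of parameter is a composition. *)
Lemma enclosed_area_primitive (P : R -> R) :
  (forall u : R, is_derive u 1 P ((c u).2 * (derive1 c u).1)) ->
  enclosed_area c = P 0 - P 1.
Proof.
move=> dP; have [th [tau [_ perth [tauth thtau] dtau ap]]] := convex_angle_param cvx.
pose X f := (c (tau f)).1; pose Y f := (c (tau f)).2.
have pertau f : tau (f + 2 * pi) = tau f + 1 by rewrite -[in LHS](thtau f) -perth tauth.
have perX f : X (f + 2 * pi) = X f by rewrite /X pertau periodic.
have perY f : Y (f + 2 * pi) = Y f by rewrite /Y pertau periodic.
have rangeE : range c = range (fun f => (X f, Y f)).
  apply/seteqP; split => _ [u _ <-].
    by exists (th u) => //; rewrite /X /Y tauth -surjective_pairing.
  by exists (tau u) => //; rewrite -surjective_pairing.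
have dQ (f : R) : is_derive f 1 (fun f => P (tau f))
    (Y f * (speed c (tau f) / turning_rate c (tau f) * cos f)).
  have [_ dX _] := ap f.
  have dX' := is_derive_chain (f := fun u => (c u).1) (g := tau)
      (is_derive_fst (curve_derive smooth (tau f))) (dtau f).
  have <- : (derive1 c (tau f)).1 * (turning_rate c (tau f))^-1 =
      speed c (tau f) / turning_rate c (tau f) * cos f.
    by rewrite -(@derive_val _ _ _ _ _ _ _ dX') (@derive_val _ _ _ _ _ _ _ dX).
  by apply: is_derive_eq (is_derive_chain (g := tau) (dP (tau f)) (dtau f)) _; rewrite mulrA.
rewrite /enclosed_area (enclosed_left_region ap perX perY rangeE).
rewrite (area_left_region ap perX perY dQ) /=.
have -> : pi + pi / 2 = - (pi / 2) + 2 * pi :> R by lra.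
rewrite pertau; set u := tau _.
suff : P (u + 1) - P u = P (0 + 1) - P 0 by rewrite add0r; lra.
apply: (@is_derive_0_is_cst _ (fun u => P (u + 1) - P u)) => v.
apply: is_derive_eq (is_derive_sub (is_derive_shift (dP (v + 1))) (dP v)) _.
by rewrite derive1_periodic// periodic subrr.
Qed.

(** Cauchy-Schwarz for the total curvature, in the form of the nonnegativity of
    the integral of [(k - 2 pi / L) ^ 2]. *)
Lemma mean_curvature_square_length_ge :
  2 * pi <= mean_curvature_square c * curve_length c.
Proof.
have ck := curvature_continuous; have cs := speed_continuous smooth regular.
have cks : continuous (fun u => curvature c u * speed c u) by move=> u; exact: cvgM (ck u) (cs u).
have ck2s : continuous (fun u => curvature c u ^+ 2 * speed c u).
  move=> u; apply: cvgM; last exact: cs.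
  exact: (continuous_comp (@ck u) (@exprn_continuous R 2 _)).
have c1s : continuous (fun u => 1 * speed c u) by move=> u; exact: cvgM (cvg_cst _) (cs u).
have [A dA] := primitive_exists ck2s.
have [B dB] := primitive_exists cks.
have [S dS] := primitive_exists c1s.
have := total_curvature; rewrite /mean_curvature_square /curve_length /arc_integral.
rewrite (Rintegral_primitive ltr01 ck2s dA) (Rintegral_primitive ltr01 cks dB).
rewrite (Rintegral_primitive ltr01 c1s dS).
have S0 : 0 < S 1 - S 0.
  rewrite subr_gt0; apply: (derive_gt0_incr (a := 0) (b := 1) dS) => // x _.
  by rewrite mul1r speed_gt0.
move=> B2; pose l := 2 * pi / (S 1 - S 0).
have : 0 <= (A 1 - A 0) - (B 1 - B 0) * (2 * l) + (S 1 - S 0) * l ^+ 2.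
  pose f u := A u - B u * (2 * l) + S u * l ^+ 2.
  have df (u : R) := is_derive_add (is_derive_sub (dA u)
    (is_derive_scale (2 * l) (dB u))) (is_derive_scale (l ^+ 2) (dS u)).
  have [|z _ fE] := @MVT R f _ 0 1 ltr01 (fun z _ => df z).
    by apply: continuous_subspaceT => z; exact: is_derive_continuous (df z).
  have -> : A 1 - A 0 - (B 1 - B 0) * (2 * l) + (S 1 - S 0) * l ^+ 2 = f 1 - f 0.
    by rewrite /f; ring.
  rewrite fE subr0 mulr1.
  have -> (k s : R) : k ^+ 2 * s - k * s * (2 * l) + 1 * s * l ^+ 2 = (k - l) ^+ 2 * s by ring.
  by rewrite mulr_ge0 ?sqr_ge0// ltW// speed_gt0.
move: B2 S0 @l; move: (A 1 - A 0) (B 1 - B 0) (S 1 - S 0) => a b s -> s0.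
have p0 := pi2_gt0 (R := R); move: (2 * pi) p0 => p p0 /=.
rewrite (_ : _ + _ = a - p ^+ 2 / s); last by field; rewrite gt_eqF.
rewrite subr_ge0 ler_pdivrMr// => ps.
by rewrite -mulrA [leRHS]mulrC ler_pdivlMr// -expr2.
Qed.

End ConvexIntegrals.

(** Integration by parts removes the derivative of the difference of the two curves. *)
Lemma area_difference (R : realType) (a b : R -> R * R) : convex_curve a -> convex_curve b ->
  enclosed_area a - enclosed_area b = \int[lebesgue_measure]_(u in `[0, 1])
    ((derive1 b u).2 * ((a u).1 - (b u).1) - ((a u).2 - (b u).2) * (derive1 a u).1).
Proof.
move=> ca cb; have sa := convex_smooth ca; have sb := convex_smooth cb.
have da u := curve_derive sa u; have db u := curve_derive sb u.
have da1 u := is_derive_continuous (is_derive_fst (curve_derive1 sa u)).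
have db1 u := is_derive_continuous (is_derive_fst (curve_derive1 sb u)).
have db2 u := is_derive_continuous (is_derive_snd (curve_derive1 sb u)).
have a1 u := is_derive_continuous (is_derive_fst (da u)).
have a2 u := is_derive_continuous (is_derive_snd (da u)).
have b1 u := is_derive_continuous (is_derive_fst (db u)).
have b2 u := is_derive_continuous (is_derive_snd (db u)).
have [P dP] : exists P : R -> R, forall u : R, is_derive u 1 P ((a u).2 * (derive1 a u).1).
  by apply: primitive_exists => u; exact: cvgM (a2 u) (da1 u).
have [Q dQ] : exists P : R -> R, forall u : R, is_derive u 1 P ((b u).2 * (derive1 b u).1).
  by apply: primitive_exists => u; exact: cvgM (b2 u) (db1 u).
rewrite (enclosed_area_primitive ca dP) (enclosed_area_primitive cb dQ).
pose H u := Q u - P u + (b u).2 * ((a u).1 - (b u).1).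
have dH (u : R) : is_derive u 1 H
    ((derive1 b u).2 * ((a u).1 - (b u).1) - ((a u).2 - (b u).2) * (derive1 a u).1).
  have := is_derive_mul (is_derive_snd (db u))
    (is_derive_sub (is_derive_fst (da u)) (is_derive_fst (db u))).
  move=> D; apply: is_derive_eq (is_derive_add (is_derive_sub (dQ u) (dP u)) D) _.
  have E (x y x' x0 y0 x0' y0' : R) : y0 * x0' - y * x' + (y0' * (x - x0) + y0 * (x' - x0')) =
      y0' * (x - x0) - (y - y0) * x' by ring.
  exact: E.
rewrite (Rintegral_primitive ltr01 _ dH); last first.
  move=> u; apply: cvgB; first by apply: cvgM; [exact: db2|exact: cvgB (a1 u) (b1 u)].
  by apply: cvgM; [exact: cvgB (a2 u) (b2 u)|exact: da1].
have a10 : a 1 = a 0 by rewrite -[1 in LHS]add0r (convex_periodic ca).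
have b10 : b 1 = b 0 by rewrite -[1 in LHS]add0r (convex_periodic cb).
by rewrite /H a10 b10; ring.
Qed.

(** * Partial derivatives as derivatives along lines *)

Section Partial.
Context {R : realType}.

Lemma compact_fun_bounded (W : R * R -> R) (A : set (R * R)) : compact A -> A !=set0 ->
  {within A, continuous W} -> exists M, forall p, A p -> `|W p| <= M.
Proof.
move=> cA A0 cW.
have [|p _ H] := @compact_EVT_max _ _ (fun p => `|W p|) A A0 cA.
  by move=> p; apply: cvg_norm; exact: cW.
by exists `|W p| => q Aq; apply: H; rewrite inE.
Qed.

Lemma is_derive_line1 (V : normedModType R) (W : R * R -> V) (s u : R) :
  differentiable W (s, u) -> is_derive s 1 (fun s => W (s, u)) ('D_(1, 0) W (s, u)).
Proof.
move=> /diff_derivable-/(_ (1, 0)) dW.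
have E : (fun h : R => h^-1 *: (W (h *: (1 : R) + s, u) - W (s, u))) =
    (fun h : R => h^-1 *: (W (h *: ((1, 0) : R * R) + (s, u)) - W (s, u))).
  apply/funext => h; congr (_ *: (W _ - _)).
  by congr pair; rewrite /= ?scaler0 ?add0r.
by apply: DeriveDef; rewrite /derivable /derive E.
Qed.

Lemma is_derive_line2 (V : normedModType R) (W : R * R -> V) (s u : R) :
  differentiable W (s, u) -> is_derive u 1 (fun u => W (s, u)) ('D_(0, 1) W (s, u)).
Proof.
move=> /diff_derivable-/(_ (0, 1)) dW.
have E : (fun h : R => h^-1 *: (W (s, h *: (1 : R) + u) - W (s, u))) =
    (fun h : R => h^-1 *: (W (h *: ((0, 1) : R * R) + (s, u)) - W (s, u))).
  apply/funext => h; congr (_ *: (W _ - _)).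
  by congr pair; rewrite /= ?scaler0 ?add0r.
by apply: DeriveDef; rewrite /derivable /derive E.
Qed.

End Partial.

(** * The flow *)

Theorem lemma9 (R : realType) (I : set R) (gamma : R -> R -> R * R)
    (I_open : open I) (I_interval : is_interval I)
    (gamma_smooth :
       smooth_on [set p : R * R | I p.1] (fun p : R * R => gamma p.1 p.2))
    (gamma_convex : forall t : R, I t -> convex_curve (gamma t))
    (gamma_flow : forall t u : R, I t ->
       is_derive t 1 (fun t' : R => gamma t' u)
         ((curvature (gamma t) u - mean_curvature_square (gamma t))
            *: normal (gamma t) u)) :
  forall t : R, I t ->
    is_derive t 1 (fun t' : R => enclosed_area (gamma t'))
      (mean_curvature_square (gamma t) * curve_length (gamma t) - 2 * pi) /\
    0 <= mean_curvature_square (gamma t) * curve_length (gamma t) - 2 * pi.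
Proof.
move=> t It; split; last by rewrite subr_ge0 mean_curvature_square_length_ge//; exact: gamma_convex.
pose Phi := fun p : R * R => gamma p.1 p.2.
pose Phi_u := 'D_(0, 1) Phi; pose Phi_t := 'D_(1, 0) Phi; pose Phi_ut := 'D_(1, 0) Phi_u.
have diff0 (p : R * R) : I p.1 -> differentiable Phi p by exact: (gamma_smooth [::]).
have diffu (p : R * R) : I p.1 -> differentiable Phi_u p by exact: (gamma_smooth [:: (0, 1)]).
have difft (p : R * R) : I p.1 -> differentiable Phi_t p by exact: (gamma_smooth [:: (1, 0)]).
have diffut (p : R * R) : I p.1 -> differentiable Phi_ut p.
  by exact: (gamma_smooth [:: (1, 0); (0, 1)]).
have Phi_uE s u : I s -> derive1 (gamma s) u = Phi_u (s, u).
  move=> Is; rewrite derive1E.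
  have := is_derive_line2 (diff0 (s, u) Is).
  by move=> D; exact: (@derive_val _ _ _ _ _ _ _ D).
pose G s u := (Phi_u (t, u)).2 * ((gamma s u).1 - (gamma t u).1)
  - ((gamma s u).2 - (gamma t u).2) * (Phi_u (s, u)).1.
pose dG s u := (Phi_u (t, u)).2 * (Phi_t (s, u)).1
  - ((Phi_t (s, u)).2 * (Phi_u (s, u)).1
     + ((gamma s u).2 - (gamma t u).2) * (Phi_ut (s, u)).1).
have G_derive s u : I s -> is_derive s 1 (G ^~ u) (dG s u).
  move=> Is; have D0 := is_derive_line1 (diff0 (s, u) Is).
  have Du := is_derive_line1 (diffu (s, u) Is).
  have D1 := is_derive_sub (is_derive_fst D0) (is_derive_const (gamma t u).1 s).
  have D2 := is_derive_sub (is_derive_snd D0) (is_derive_const (gamma t u).2 s).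
  apply: is_derive_eq (is_derive_sub
    (is_derive_mul (is_derive_const (Phi_u (t, u)).2 s) D1)
    (is_derive_mul D2 (is_derive_fst Du))) _.
  by rewrite /dG mul0r add0r !subr0.
have areaE s : I s -> enclosed_area (gamma s) =
    \int[lebesgue_measure]_(u in `[0, 1]) G s u + enclosed_area (gamma t).
  move=> Is; apply/eqP; rewrite -subr_eq; apply/eqP.
  rewrite (area_difference (gamma_convex s Is) (gamma_convex t It)).
  by apply: eq_Rintegral => u _; rewrite !Phi_uE.
have cont_fst (W : R * R -> R * R) p : differentiable W p -> {for p, continuous (fun q => (W q).1)}.
  move=> /differentiable_continuous cW.
  by apply: (@cvg_comp _ _ _ W (fun p : R * R => p.1) _ (nbhs (W p))); [exact: cW|exact: cvg_fst].
have cont_snd (W : R * R -> R * R) p : differentiable W p -> {for p, continuous (fun q => (W q).2)}.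
  move=> /differentiable_continuous cW.
  by apply: (@cvg_comp _ _ _ W (fun p : R * R => p.2) _ (nbhs (W p))); [exact: cW|exact: cvg_snd].
have slice (f : R * R -> R) (s : R) (p : R * R) : {for (s, p.2), continuous f} ->
    {for p, continuous (fun q : R * R => f (s, q.2))}.
  move=> cf.
  have c1 : continuous (fun q : R * R => s) by move=> ?; exact: cvg_cst.
  have c2 : {for p, continuous (fun q : R * R => q.2)}.
    exact: (@cvg_snd _ _ (nbhs p.1) (nbhs p.2)).
  have c12 : {for p, continuous (fun q : R * R => (s, q.2))} by exact: (cvg_pair (c1 p) c2).
  exact: (continuous_comp c12 cf).
have G_cont s : I s -> continuous (G s).
  move=> Is u.
  have line (f : R * R -> R) (v : R) : {for (v, u), continuous f} -> {for u, continuous (fun w : R => f (v, w))}.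
    move=> cf.
    have d1 : continuous (fun w : R => v) by move=> ?; exact: cvg_cst.
    have d12 : {for u, continuous (fun w : R => (v, w))}.
      exact: (cvg_pair (d1 u) (@cvg_id _ (nbhs u))).
    exact: (continuous_comp d12 cf).
  have c1 := line _ t (cont_snd _ (t, u) (diffu (t, u) It)).
  have c2 := line _ s (cont_fst _ (s, u) (diff0 (s, u) Is)).
  have c3 := line _ t (cont_fst _ (t, u) (diff0 (t, u) It)).
  have c4 := line _ s (cont_snd _ (s, u) (diff0 (s, u) Is)).
  have c5 := line _ t (cont_snd _ (t, u) (diff0 (t, u) It)).
  have c6 := line _ s (cont_fst _ (s, u) (diffu (s, u) Is)).
  exact: (cvgB (cvgM c1 (cvgB c2 c3)) (cvgM (cvgB c4 c5) c6)).
have dG_cont (p : R * R) : I p.1 -> {for p, continuous (fun q => dG q.1 q.2)}.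
  move=> Ip.
  have c1 := slice _ t p (cont_snd _ (t, p.2) (diffu (t, p.2) It)).
  have c2 := cont_fst _ p (difft p Ip).
  have c3 := cont_snd _ p (difft p Ip).
  have c4 := cont_fst _ p (diffu p Ip).
  have c5 := cont_snd _ p (diff0 p Ip).
  have c6 := slice _ t p (cont_snd _ (t, p.2) (diff0 (t, p.2) It)).
  have c7 := cont_fst _ p (diffut p Ip).
  have -> : (fun q => dG q.1 q.2) = fun q => (Phi_u (t, q.2)).2 * (Phi_t q).1
      - ((Phi_t q).2 * (Phi_u q).1 + ((Phi q).2 - (Phi (t, q.2)).2) * (Phi_ut q).1).
    by apply/funext => -[].
  exact: (cvgB (cvgM c1 c2) (cvgD (cvgM c3 c4) (cvgM (cvgB c5 c6) c7))).
have [e e0 eI] : exists2 e, 0 < e & forall s, t - e <= s <= t + e -> I s.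
  have /nbhs_ballP[e /= e0 He] : nbhs t I by exact: open_nbhs_nbhs.
  exists (e / 2); first by rewrite divr_gt0.
  move=> s /andP[s1 s2]; apply: He; rewrite /ball/= ltr_distlC; apply/andP; split; lra.
have [M HM] : exists M, forall p, (`[t - e, t + e] `*` `[0, 1])%classic p -> `|dG p.1 p.2| <= M.
  apply: (@compact_fun_bounded R (fun p => dG p.1 p.2)).
  - by apply: compact_setX; exact: segment_compact.
  - by exists (t, 0); split; rewrite /= in_itv/=; apply/andP; split; lra.
  - apply: continuous_in_subspaceT => p; rewrite inE => -[/= p1 _].
    by apply: dG_cont; apply: eI; move: p1; rewrite in_itv.
have mB : measurable (`[0, 1]%classic : set (measurableTypeR R)) by [].
have Ia : `](t - e), (t + e)[%classic t by rewrite /= in_itv/=; apply/andP; split; lra.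
have intG s : `](t - e), (t + e)[%classic s ->
    (@lebesgue_measure R).-integrable `[0, 1]%classic (EFin \o G s).
  rewrite /= in_itv/= => /andP[s1 s2].
  apply: continuous_compact_integrable; first exact: segment_compact.
  by apply: continuous_subspaceT; apply: G_cont; apply: eI; rewrite !ltW.
have derG s (u : measurableTypeR R) : `](t - e), (t + e)[%classic s -> `[0, 1]%classic u ->
    derivable (G ^~ u) s 1.
  rewrite /= in_itv/= => /andP[s1 s2] _; apply: (@ex_derive _ _ _ _ _ _ (dG s u)).
  by apply: G_derive; apply: eI; rewrite !ltW.
have intM : (@lebesgue_measure R).-integrable `[0, 1]%classic
    (EFin \o (fun _ : measurableTypeR R => `|M|)).
  apply: continuous_compact_integrable; first exact: segment_compact.
  by apply: continuous_subspaceT => x; exact: cvg_cst.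
have ubM s (u : measurableTypeR R) : `](t - e), (t + e)[%classic s -> `[0, 1]%classic u ->
    `|partial1of2 G s u| <= `|M|.
  rewrite /= !in_itv/= => /andP[s1 s2] u01; rewrite partial1of2E.
  have Is : I s by apply: eI; rewrite !ltW.
  rewrite (@derive_val _ _ _ _ _ _ _ (G_derive s u Is)).
  rewrite (le_trans (HM (s, u) _)) ?ler_norm//.
  by split; rewrite /= in_itv/= ?u01// !ltW.
have dF := @derivable_under_integral R _ _ (@lebesgue_measure R) G _ mB t _ _ Ia intG derG
  (fun=> `|M|) (fun=> normr_ge0 M) intM ubM.
have F' := @differentiation_under_integral R _ _ (@lebesgue_measure R) G _ mB t _ _ Ia intG derG
  (fun=> `|M|) (fun=> normr_ge0 M) intM ubM.
rewrite derive1E in F'.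
apply: (@near_eq_is_derive _ _ _ (fun s => \int[lebesgue_measure]_(u in `[0, 1]) G s u
    + enclosed_area (gamma t))).
  have /nbhs_ballP[d /= d0 Hd] : nbhs t I by exact: open_nbhs_nbhs.
  by apply/nbhs_ballP; exists d => // s ts; rewrite (areaE s)//; exact: Hd.
apply: is_derive_eq (is_derive_add (DeriveDef dF F') (is_derive_const _ t)) _.
rewrite addr0; have ct := gamma_convex t It.
have smooth := convex_smooth ct; have regular := convex_regular ct.
have ck := curvature_continuous ct; have cs := speed_continuous smooth regular.
set alpha := mean_curvature_square _ in gamma_flow *.
have cks : continuous (fun u => curvature (gamma t) u * speed (gamma t) u).
  by move=> u; exact: cvgM (ck u) (cs u).
have c1s : continuous (fun u => 1 * speed (gamma t) u).
  by move=> u; exact: cvgM (cvg_cst _) (cs u).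
have [B dB] := primitive_exists cks.
have [S dS] := primitive_exists c1s.
have dH (u : R) := is_derive_sub (is_derive_scale alpha (dS u)) (dB u).
have := total_curvature ct; rewrite /curve_length /arc_integral.
rewrite (Rintegral_primitive ltr01 cks dB) (Rintegral_primitive ltr01 c1s dS) => <-.
transitivity (S 1 * alpha - B 1 - (S 0 * alpha - B 0)); last by ring.
rewrite -(Rintegral_primitive ltr01 _ dH); last first.
  move=> u; apply: cvgB; last exact: cks.
  by apply: cvgM; [exact: c1s|exact: cvg_cst].
apply: eq_Rintegral => u _; rewrite -/(partial1of2 G t u) partial1of2E.
rewrite (@derive_val _ _ _ _ _ _ _ (G_derive t u It)) /dG.
have Phi_tE : Phi_t (t, u) = (curvature (gamma t) u - alpha) *: normal (gamma t) u.
  rewrite -(@derive_val _ _ _ _ _ _ _ (gamma_flow t u It)).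
  by rewrite (@derive_val _ _ _ _ _ _ _ (is_derive_line1 (diff0 (t, u) It))).
have s0 : speed (gamma t) u != 0 by rewrite gt_eqF// speed_gt0.
rewrite Phi_tE -!Phi_uE// /normal /rot90 tangentE /= /GRing.scale/=.
have E (p q k a x z v : R) : v != 0 -> v ^+ 2 = p ^+ 2 + q ^+ 2 ->
    q * ((k - a) * - (q / v)) - ((k - a) * (p / v) * p + (x - x) * z) = 1 * v * a - k * v.
  move=> v0 vE; transitivity ((a - k) * (p ^+ 2 + q ^+ 2) / v); first by ring.
  by rewrite -vE; field.
exact: E s0 (speed_sqr (gamma t) u).
Qed.
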